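(* Let $\Pi$ be an EFC process with characteristics $(c_k,\nu_{Coag},c_e,\nu_{Disl})$ which are not all zero simultaneously. Then there exists a unique stationary probability measure $\rho$ on $\mathcal P$ for $\Pi$; it is exchangeable, and $$\rho=\delta_{\mathbf 0}\iff c_k=0\text{ and }\nu_{Coag}\equiv 0,\qquad \rho=\delta_{\mathbf 1}\iff c_e=0\text{ and }\nu_{Disl}\equiv 0,$$ where $\delta_\pi$ is the Dirac mass at $\pi$. Furthermore, $\Pi(t)$ converges in distribution to $\rho$ as $t\to\infty$.
   Context: Partitions. $\mathbb N=\{1,2,\dots\}$, $[n]=\{1,\dots,n\}$. $\mathcal P$ (resp. $\mathcal P_n$) is the set of partitions of $\mathbb N$ (resp. $[n]$); $\pi=(B_1,B_2,\dots)$ lists the blocks in increasing order of least element (followed by empty blocks if there are finitely many). $i\overset{\pi}{\sim}j$ means $i,j$ are in the same block of $\pi$; $\pi_{|[n]}$ is the restriction to $[n]$; $\#\pi$ is the number of non-empty blocks; $\mathbf 0$ is the partition into singletons, $\mathbf 1$ the one-block partition, $\mathbf 0_n,\mathbf 1_n$ their restrictions to $[n]$. $\mathcal P$ carries the compact metric $d(\pi,\pi')=1/\max\{n:\pi_{|[n]}=\pi'_{|[n]}\}$ ($0$ if $\pi=\pi'$). For a permutation $\sigma$, $\sigma(\pi)$ is defined by $i\overset{\sigma(\pi)}{\sim}j\iff\sigma(i)\overset{\pi}{\sim}\sigma(j)$. A random partition, measure or $\mathcal P$-valued process is exchangeable if its law is invariant under every permutation $\sigma$ of $\mathbb N$ with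 $\sigma(n)=n$ for all large $n$. Operators. For $\pi=(B_i)$, $\pi'=(B'_j)$: $Coag(\pi,\pi')$ has blocks $\bigcup_{i\in B'_j}B_i$; $Frag(\pi,\pi',k)$ keeps every $B_i$, $i\ne k$, and replaces $B_k$ by the non-empty sets $B_k\cap B'_j$. For $\pi\in\mathcal P_n$, $Coag(\pi,\pi')$ is defined likewise for $\pi'\in\mathcal P_{\#\pi}$, and for $\pi'\in\mathcal P_{|B_k|}$, $Frag(\pi,\pi',k)$ is defined by identifying $B_k$ with $[|B_k|]$ via the increasing bijection. EFC processes. An EFC (exchangeable fragmentation-coalescence) process is an exchangeable $\mathcal P$-valued Markov process $(\Pi(t))_{t\ge0}$ whose restrictions $\Pi_{|[n]}$ are càdlàg finite-state Markov chains whose transition rates $q_n(\pi,\pi')$ are non-zero only if $\pi'=Coag(\pi,\pi'')$ for some $\pi''$ or $\pi'=Frag(\pi,\pi'',k)$ for some $\pi'',k$. Characteristics. $\mathcal S^\downarrow=\{x=(x_1\ge x_2\ge\dots\ge0):\sum_i x_i\le1\}$. For $x\in\mathcal S^\downarrow$, $\mu_x$ is the law of the partition with $i\sim j\iff X_i=X_j$, where the $X_i$ are independent, $P(X_i=k)=x_k$ ($k\ge1$), $P(X_i=-i)=1-\sum_jx_j$; $\mu_\nu=\int\mu_x\,\nu(dx)$. $\mathbf e=\sum_n\delta_{\epsilon_n}$, $\epsilon_n$ having blocks $\{n\}$, $\mathbb N\setminus\{n\}$; $\kappa=\sum_{i<j}\delta_{\epsilon_{i,j}}$, $\epsilon_{i,j}$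 having $\{i,j\}$ as only non-singleton block. Characteristics are $c_k,c_e\ge0$ and measures $\nu_{Coag},\nu_{Disl}$ on $\mathcal S^\downarrow$ with $\nu_{Coag}(\{(0,0,\dots)\})=0$, $\int\sum_ix_i^2\,\nu_{Coag}(dx)<\infty$, $\nu_{Disl}(\{(1,0,\dots)\})=0$, $\int(1-\sum_ix_i^2)\,\nu_{Disl}(dx)<\infty$. With $C=c_k\kappa+\mu_{\nu_{Coag}}$ and $F=c_e\mathbf e+\mu_{\nu_{Disl}}$, an EFC process has these characteristics if, for $\pi\in\mathcal P_n$ with $m$ blocks, $q_n(\pi,Coag(\pi,\pi'))=C(\{\pi'':\pi''_{|[m]}=\pi'\})$ for $\pi'\in\mathcal P_m\setminus\{\mathbf 0_m\}$, $q_n(\pi,Frag(\pi,\pi',k))=F(\{\pi'':\pi''_{|[|B_k|]}=\pi'\})$ for $\pi'\in\mathcal P_{|B_k|}\setminus\{\mathbf 1_{|B_k|}\}$, and all other rates vanish. Every EFC process has unique characteristics. Stationarity refers to the Markov semigroup on $\mathcal P$ whose restrictions to each $[n]$ are the Markov chains with these rates (started from an arbitrary $\pi\in\mathcal P$). *)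

(* Defs.v *)
From HB Require Import structures.
From mathcomp Require Import all_boot all_order all_algebra.
From mathcomp Require Import all_classical all_reals all_analysis.
From mathcomp Require Import measurable_realfun giry.
Set Implicit Arguments.
Unset Strict Implicit.
Unset Printing Implicit Defensive.
Import Order.TTheory GRing.Theory Num.Theory numFieldNormedType.Exports.
Local Open Scope classical_set_scope.
Local Open Scope ring_scope.

(* A partition of T is encoded by the equivalence relation "being in the same
   block".  Integers are shifted by one: [nat] and ['I_n] stand for
   {1, 2, ...} and {1, ..., n}, the element i standing for i + 1. *)
Record ptn (T : Type) := Ptn {
  ptn_rel :> rel T;
  ptn_equiv : equivalence_rel ptn_rel }.

Section PtnTheory.
Variable T : Type.
Implicit Types p : ptn T.

Lemma ptn_ext p p' : (forall i j, p i j = p' i j) -> p = p'.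
Proof.
case: p p' => [r e] [r' e'] /= rr'.
have {rr'} rr' : r = r' by apply/funext => i; apply/funext => j.
by rewrite -rr' in e' *; congr Ptn; apply: Prop_irrelevance.
Qed.

Lemma ptn_refl p i : p i i.
Proof. by case: p => r e; case: (e i i i). Qed.

Lemma ptn_trans_eq p i j k : p i j -> p i k = p j k.
Proof. by case: p => r e /=; case: (e i j k) => _; apply. Qed.

Lemma ptn_sym p i j : p i j = p j i.
Proof.
apply/idP/idP => h.
  by rewrite -(ptn_trans_eq i h) ptn_refl.
by rewrite -(ptn_trans_eq j h) ptn_refl.
Qed.

HB.instance Definition _ := gen_eqMixin (ptn T).
HB.instance Definition _ := gen_choiceMixin (ptn T).

End PtnTheory.

Section PtnFinite.
Variable T : finType.

Definition ptn_code (p : ptn T) : {ffun T * T -> bool} :=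
  [ffun u => p u.1 u.2].

Definition ptn_decode (f : {ffun T * T -> bool}) : option (ptn T) :=
  match pselect (equivalence_rel (fun i j => f (i, j))) with
  | left e => Some (Ptn e)
  | right _ => None
  end.

Lemma ptn_codeK : pcancel ptn_code ptn_decode.
Proof.
move=> p; rewrite /ptn_decode.
have E : (fun i j => ptn_code p (i, j)) = p.
  by apply/funext => i; apply/funext => j; rewrite ffunE.
case: pselect => [e|]; last by case; rewrite E; exact: ptn_equiv.
by congr Some; apply: ptn_ext => i j /=; rewrite ffunE.
Qed.

HB.instance Definition _ := PCanIsCountable ptn_codeK.

Definition ptn_enum : seq (ptn T) :=
  undup (pmap ptn_decode (enum {ffun T * T -> bool})).

Lemma ptn_enumP : Finite.axiom ptn_enum.
Proof.
apply: Finite.uniq_enumP; first exact: undup_uniq.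
move=> p; rewrite mem_undup mem_pmap; apply/mapP.
by exists (ptn_code p); rewrite ?ptn_codeK // fintype.mem_enum.
Qed.

HB.instance Definition _ := fintype.isFinite.Build (ptn T) ptn_enumP.

End PtnFinite.

Lemma pullback_equiv (T S : Type) (f : T -> S) (p : ptn S) :
  equivalence_rel (fun i j => p (f i) (f j)).
Proof. by move=> i j k; split; [exact: ptn_refl|exact: ptn_trans_eq]. Qed.

Definition pullback (T S : Type) (f : T -> S) (p : ptn S) : ptn T :=
  Ptn (pullback_equiv f p).

Definition restr (n : nat) (p : ptn nat) : ptn 'I_n :=
  pullback (@nat_of_ord n) p.

Lemma ptn0_equiv (T : eqType) : equivalence_rel (@eq_op T).
Proof. by move=> i j k; split=> // /eqP ->. Qed.

(* The partition into singletons, usually denoted 0. *)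
Definition ptn0 (T : eqType) : ptn T := Ptn (@ptn0_equiv T).

Lemma ptn1_equiv (T : Type) : equivalence_rel (fun _ _ : T => true).
Proof. by []. Qed.

(* The partition with one block, usually denoted 1. *)
Definition ptn1 (T : Type) : ptn T := Ptn (@ptn1_equiv T).

Section CoagFrag.
Variable n : nat.
Implicit Types p : ptn 'I_n.

Definition leaders p : {set 'I_n} :=
  [set i | [forall j, p i j ==> (i <= j)%N]].

Definition nblocks p : nat := #|leaders p|.

(* The leaders of the blocks listed strictly before the block of i. *)
Definition earlier p (i : 'I_n) : {set 'I_n} :=
  [set l in leaders p | [forall j, p i j ==> (l < j)%N]].

Lemma earlier_lt p i : (#|earlier p i| < nblocks p)%N.
Proof.
apply: proper_card; apply/properP; split.
  by apply/fintype.subsetP => l; rewrite inE => /andP[].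
have [l pil lmin] := arg_minnP (fun j : 'I_n => j : nat) (ptn_refl p i).
exists l.
  rewrite inE; apply/forallP => j; apply/implyP => plj.
  by apply: lmin; rewrite /= (ptn_trans_eq j pil).
by rewrite inE negb_and; apply/orP; right; apply/forallPn; exists l;
  rewrite negb_imply pil /= ltnn.
Qed.

(* The index of the block containing i, blocks being listed in increasing
   order of their least elements. *)
Definition bidx p (i : 'I_n) : 'I_(nblocks p) := Ordinal (earlier_lt p i).

Definition block p (k : 'I_(nblocks p)) : {set 'I_n} :=
  [set i | bidx p i == k].

Definition coag p (p' : ptn 'I_(nblocks p)) : ptn 'I_n :=
  pullback (bidx p) p'.

Lemma bidxE p i j : (bidx p i == bidx p j) = p i j.
Proof.
have min_ex (a : 'I_n) :
    exists l, [/\ p a l, l \in leaders p & forall j, p a j -> (l <= j)%N].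
  have [l pal lmin] := arg_minnP (fun j : 'I_n => j : nat) (ptn_refl p a).
  exists l; split => //; rewrite inE; apply/forallP => b; apply/implyP => plb.
  by apply: lmin; rewrite /= (ptn_trans_eq b pal).
apply/idP/idP; last first.
  move=> pij; suff e : earlier p i = earlier p j by rewrite -val_eqE /= e.
  apply/finset.setP => l; rewrite !inE; congr (_ && _); apply: eq_forallb => k.
  by rewrite (ptn_trans_eq k pij).
rewrite -val_eqE /=.
have aux a b la lb : p a la -> la \in leaders p ->
    (forall j, p a j -> (la <= j)%N) -> p b lb ->
    (forall j, p b j -> (lb <= j)%N) -> (la < lb)%N ->
    (#|earlier p a| < #|earlier p b|)%N.
  move=> pala La ma pblb mb lalb; apply: proper_card; apply/properP; split.
    apply/fintype.subsetP => l; rewrite !inE => /andP[-> /forallP h] /=.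
    apply/forallP => k; apply/implyP => pbk.
    apply: (@leq_trans la); first by have /implyP := h la; exact.
    by apply: leq_trans (ltnW lalb) _; exact: mb.
  exists la.
    rewrite inE La /=; apply/forallP => k; apply/implyP => pbk.
    by apply: leq_trans lalb _; exact: mb.
  rewrite inE negb_and; apply/orP; right; apply/forallPn; exists la.
  by rewrite negb_imply pala /= ltnn.
have [la [pa La ma]] := min_ex i; have [lb [pb Lb mb]] := min_ex j.
have [lt|lt|/val_inj e] := ltngtP la lb.
- by have := aux _ _ _ _ pa La ma pb mb lt => /ltn_eqF ->.
- by have := aux _ _ _ _ pb Lb mb pa ma lt => /gtn_eqF ->.
- by move=> _; rewrite (ptn_trans_eq j pa) e ptn_sym.
Qed.

(* As the enumeration of ['I_n] is increasing, [enum_val] is the increasing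
   bijection from ['I_#|B|] to B. *)
Definition frag_rel p (k : 'I_(nblocks p)) (p' : ptn 'I_#|block k|) : rel 'I_n :=
  fun i j => p i j && ((i \in block k) ==>
    [exists a : 'I_#|block k|, exists b : 'I_#|block k|,
      [&& enum_val a == i, enum_val b == j & p' a b]]).

Lemma frag_equiv p (k : 'I_(nblocks p)) (p' : ptn 'I_#|block k|) :
  equivalence_rel (frag_rel p').
Proof.
have blk i j : p i j -> (i \in block k) = (j \in block k).
  by move=> pij; rewrite !inE; move: pij; rewrite -bidxE => /eqP ->.
move=> i j l; split.
  rewrite /frag_rel ptn_refl /=; apply/implyP => iB.
  apply/existsP; exists (enum_rank_in iB l); apply/existsP.
  by exists (enum_rank_in iB l); rewrite enum_rankK_in // eqxx ptn_refl.
rewrite /frag_rel => /andP[pij]; rewrite (ptn_trans_eq l pij) -(blk _ _ pij).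
move=> /implyP h; congr (_ && _); case iB : (i \in _) h => //= h.
have /existsP[a /existsP[b /and3P[/eqP ai /eqP bj pab]]] := h isT.
apply/existsP/existsP => -[c /existsP[e /and3P[/eqP cx /eqP ey pce]]].
  exists b; apply/existsP; exists e; rewrite bj ey !eqxx /=.
  have ca : c = a by apply: enum_val_inj; rewrite cx ai.
  by rewrite -(ptn_trans_eq e pab) -ca.
exists a; apply/existsP; exists e; rewrite ai ey !eqxx /=.
have cb : c = b by apply: enum_val_inj; rewrite cx bj.
by rewrite (ptn_trans_eq e pab) -cb.
Qed.

Definition frag p (k : 'I_(nblocks p)) (p' : ptn 'I_#|block k|) : ptn 'I_n :=
  Ptn (frag_equiv p').

End CoagFrag.

Section PtnTopology.

HB.instance Definition _ := isPointed.Build (ptn nat) (ptn0 nat).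

Definition agree (n : nat) (p : ptn nat) : set (ptn nat) :=
  [set p' | restr n p = restr n p'].

Definition ptn_nbhs (p : ptn nat) : set_system (ptn nat) :=
  filter_from setT (fun n => agree n p).

HB.instance Definition _ := hasNbhs.Build (ptn nat) ptn_nbhs.

Lemma restr_eqP n p p' : restr n p = restr n p' <->
  (forall i j, (i < n)%N -> (j < n)%N -> p i j = p' i j).
Proof.
split=> [h i j ni nj|h].
  by have := congr1 (fun r : ptn 'I_n => r (Ordinal ni) (Ordinal nj)) h.
by apply: ptn_ext => i j /=; exact: h.
Qed.

Lemma agree_le m n p : (m <= n)%N -> agree n p `<=` agree m p.
Proof.
move=> mn p' /restr_eqP h; apply/restr_eqP => i j im jm.
by apply: h; [exact: leq_trans mn|exact: leq_trans mn].
Qed.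

Lemma ptn_nbhs_filter p : ProperFilter (ptn_nbhs p).
Proof.
apply: filter_from_proper; last by move=> n _; exists p.
apply: filter_from_filter; first by exists 0%N.
move=> i j _ _; exists (maxn i j) => // p' h.
by split; [exact: (agree_le (leq_maxl i j))|exact: (agree_le (leq_maxr i j))].
Qed.

Lemma ptn_nbhs_singleton p A : ptn_nbhs p A -> A p.
Proof. by move=> [n _]; apply. Qed.

Lemma ptn_nbhs_nbhs p A : ptn_nbhs p A -> ptn_nbhs p (ptn_nbhs^~ A).
Proof.
move=> [n _ nA]; exists n => // p' pp'; exists n => // p'' p'p''.
by apply: nA; rewrite /agree /= pp'.
Qed.

HB.instance Definition _ := Nbhs_isNbhsTopological.Build (ptn nat)
  ptn_nbhs_filter ptn_nbhs_singleton ptn_nbhs_nbhs.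

HB.instance Definition _ := @isMeasurable.Build (sigma_display (@open (ptn nat)))
  (ptn nat) <<s @open (ptn nat) >> (@sigma_algebra0 _ setT _)
  (@sigma_algebraC _ _) (@sigma_algebra_bigcup _ setT _).

Lemma open_ptn_cylinders (U : set (ptn nat)) : open U ->
  U = \bigcup_n \bigcup_(r in [set r | restr n @^-1` [set r] `<=` U])
        restr n @^-1` [set r].
Proof.
rewrite openE => oU; apply/seteqP; split => p /=.
  move=> /oU[n _ nU]; exists n => //; exists (restr n p) => // p' /= pp'.
  by apply: nU; rewrite /agree /= pp'.
by move=> [n _ [r rU pr]]; exact: rU.
Qed.

Lemma measurable_fun_ptn d (T : measurableType d) (f : T -> ptn nat) :
  (forall i j, measurable [set w | f w i j]) -> measurable_fun setT f.
Proof.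
move=> mf; apply: (@measurability _ _ _ _ setT f open) => // _ [U oU <-].
rewrite setTI (open_ptn_cylinders oU) preimage_bigcup.
apply: bigcup_measurable => n _; rewrite preimage_bigcup.
apply: fin_bigcup_measurable; first exact: finite_finset.
move=> r _.
have -> : f @^-1` (restr n @^-1` [set r]) =
    \bigcap_(i : 'I_n) \bigcap_(j : 'I_n)
      (if r i j then [set w | f w i j] else ~` [set w | f w i j]).
  apply/seteqP; split => w /=.
    move=> <- i _ j _; rewrite /=; case: ifP => //.
    by move=> /negP.
  move=> h; apply: ptn_ext => i j /=; have := h i I j I.
  by case: (r i j) => /= [->|/negP/negbTE].
apply: fin_bigcap_measurable; first exact: finite_finset.
move=> i _; apply: fin_bigcap_measurable; first exact: finite_finset.
by move=> j _; case: ifP => _; [exact: mf|exact/measurableC/mf].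
Qed.

Definition ptn_dist (R : realType) (p p' : ptn nat) : R :=
  if p == p' then 0
  else (sup [set (n%:R : R) | n in [set n | restr n p = restr n p']])^-1.

Lemma ptn_distP (R : realType) (p p' : ptn nat) (n : nat) :
  ptn_dist R p p' < n.+1%:R^-1 <-> restr n.+2 p = restr n.+2 p'.
Proof.
rewrite /ptn_dist; case: eqP => [->|pp']; first by rewrite invr_gt0 ltr0Sn.
pose D := [set n | restr n p = restr n p'].
have D1 : D 1%N.
  by apply/restr_eqP => -[|i] [|j] // _ _; rewrite !ptn_refl.
have [m Dm] : exists m, ~ D m.
  apply: contrapT => h; apply: pp'; apply: ptn_ext => i j.
  have /restr_eqP : D (maxn i j).+1.
    by apply: contrapT => nD; apply: h; exists (maxn i j).+1.
  by apply; rewrite ltnS ?leq_maxl ?leq_maxr.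
have Dle a b : (a <= b)%N -> D b -> D a by move=> ab; exact: agree_le.
have Db a : D a -> (a < m)%N.
  by move=> Da; rewrite ltnNge; apply/negP => ma; exact: Dm (Dle _ _ ma Da).
have hs : has_sup [set (n%:R : R) | n in D].
  split; first by exists 1, 1%N.
  by exists m%:R => _ [a Da <-]; rewrite ler_nat ltnW // Db.
have s1 : 1 <= sup [set (n%:R : R) | n in D].
  by apply: sup_upper_bound => //; exists 1%N.
rewrite ltf_pV2 ?posrE ?ltr0Sn//; last exact: lt_le_trans s1.
split=> [lt|Dn]; last first.
  apply: (@lt_le_trans _ _ n.+2%:R); first by rewrite ltr_nat.
  by apply: sup_upper_bound => //; exists n.+2.
have [_ [a Da <-] lta] := sup_gt hs.1 lt.
by apply: Dle Da; rewrite -(@ltr_nat R).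
Qed.

Lemma nbhs_ptn_distE (R : realType) (p : ptn nat) (A : set (ptn nat)) :
  nbhs p A <-> exists2 e : R, 0 < e & forall p', ptn_dist R p p' < e -> A p'.
Proof.
split=> [[n _ nA]|[e e0 eA]].
  exists n.+1%:R^-1 => [|p' /ptn_distP h]; first by rewrite invr_gt0 ltr0Sn.
  by apply: nA; apply: (agree_le _ h); rewrite -addn2 leq_addr.
have [n ne] : exists n, n.+1%:R^-1 < e.
  by near \oo => n; exists n; near: n; exact: near_infty_natSinv_lt (PosNum e0).
exists n.+2 => // p' h; apply: eA; apply: lt_trans ne.
exact/ptn_distP.
Unshelve. all: by end_near. Qed.

End PtnTopology.

(* The space of nonincreasing sequences of sum at most 1; x i is the usual
   coordinate number i + 1. *)
Record mass_ptn (R : realType) := MassPtn {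
  mass :> nat -> R;
  mass_ge0 : forall i, 0 <= mass i;
  mass_noninc : forall i, mass i.+1 <= mass i;
  mass_sum : (\sum_(0 <= i <oo) (mass i)%:E <= 1)%E }.

Section MassMeasurable.
Variable R : realType.

HB.instance Definition _ := gen_eqMixin (mass_ptn R).
HB.instance Definition _ := gen_choiceMixin (mass_ptn R).

Lemma mass0_sum : (\sum_(0 <= i <oo) (0 : R)%:E <= 1)%E.
Proof. by rewrite eseries0. Qed.

HB.instance Definition _ := isPointed.Build (mass_ptn R)
  (@MassPtn R (fun=> 0) (fun=> lexx 0) (fun=> lexx 0) mass0_sum).

(* The coordinates generate the Borel sigma-algebra of the product topology,
   which is also that of the uniform topology on this set. *)
Definition mass_coord : set (set (mass_ptn R)) :=
  [set A | exists i, exists2 B : set R,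
     measurable B & A = [set x : mass_ptn R | B (x i)]].

HB.instance Definition _ := @isMeasurable.Build (sigma_display mass_coord)
  (mass_ptn R) <<s mass_coord >> (@sigma_algebra0 _ setT _)
  (@sigma_algebraC _ _) (@sigma_algebra_bigcup _ setT _).

End MassMeasurable.

(* mu is the law of the partition of the integers by the values of independent
   X_i, where X_i = k with probability x_k for k >= 1 and X_i = - i with the
   remaining probability. *)
Definition paintbox_law (R : realType) (x : mass_ptn R)
    (mu : probability (ptn nat) R) : Prop :=
  exists d (Omega : measurableType d) (P : probability Omega R)
         (X : nat -> Omega -> int),
  [/\ forall i (A : set int), measurable (X i @^-1` A),
      forall (s : seq nat) (A : nat -> set int), uniq s ->
        P (\bigcap_(i in [set` s]) X i @^-1` A i) =
        (\prod_(i <- s) P (X i @^-1` A i))%E,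
      forall i k, P (X i @^-1` [set k.+1%:Z]) = (x k)%:E,
      forall i, P (X i @^-1` [set - i.+1%:Z]) =
        (1 - \sum_(0 <= k <oo) (x k)%:E)%E
    & forall A, measurable A ->
        mu A = P [set w | A (pullback (X^~ w) (ptn0 int))]].

Section PaintboxExists.
Variables (R : realType) (x : mass_ptn R).

Local Notation lam := (@lebesgue_measure R).
Local Notation I01 := (`[0, 1[%classic : set R).

Let dust : R := 1 - fine (\sum_(0 <= k <oo) (x k)%:E).
Let p (k : nat) : R := if k is j.+1 then x j else dust.
Let F (k : nat) : R := \sum_(i < k) p i.
Let J (k : nat) : set R := `[F k, F k.+1[%classic.
Let idx (u : R) : nat := xget 0%N [set k | J k u].
Let g (k : nat) (u : R) : R := (u - F k) / p k.
Let res (u : R) : R := g (idx u) u.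

Let sum_ge0 : (0 <= \sum_(0 <= k <oo) (x k)%:E)%E.
Proof. by apply: nneseries_ge0 => k _ _; rewrite lee_fin mass_ge0. Qed.

Let sum_fin : (\sum_(0 <= k <oo) (x k)%:E)%E \is a fin_num.
Proof. by rewrite ge0_fin_numE// (le_lt_trans (mass_sum x)) ?ltry. Qed.

Let dustE : dust%:E = (1 - \sum_(0 <= k <oo) (x k)%:E)%E.
Proof. by rewrite /dust EFinB fineK. Qed.

Let p_ge0 k : 0 <= p k.
Proof.
case: k => [|k] /=; last exact: mass_ge0.
by rewrite /dust subr_ge0 -lee_fin fineK // mass_sum.
Qed.

Let FS k : F k.+1 = F k + p k.
Proof. by rewrite /F big_ord_recr. Qed.

Let F_le k l : (k <= l)%N -> F k <= F l.
Proof.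
move=> /subnK <-; elim: (l - k)%N => // m ih; rewrite addSn FS.
by apply: le_trans ih _; rewrite lerDl p_ge0.
Qed.

Let F_cvg : F k @[k --> \oo] --> (1 : R).
Proof.
rewrite -cvg_shiftS /=.
have -> : (fun n => F n.+1) = (fun n => dust + \sum_(0 <= i < n) x i).
  by apply/funext => n; rewrite /F big_ord_recl big_mkord.
have -> : (1 : R) = dust + fine (\sum_(0 <= k <oo) (x k)%:E)%E.
  by rewrite /dust subrK.
apply: cvgD; first exact: cvg_cst.
have -> : (fun n => \sum_(0 <= i < n) x i) =
    fine \o (fun n => \sum_(0 <= i < n) (x i)%:E)%E.
  by apply/funext => n /=; rewrite sumEFin.
apply: fine_cvg; rewrite fineK //.
by apply: is_cvg_nneseries => k _ _; rewrite lee_fin mass_ge0.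
Qed.

Let F_le1 k : F k <= 1.
Proof.
have <- : limn F = 1 by apply: cvg_lim F_cvg.
apply: nondecreasing_cvgn_le; first by move=> m n mn; exact: F_le.
by apply/cvg_ex; exists 1; exact: F_cvg.
Qed.

Let Jex u : I01 u -> exists k, J k u.
Proof.
rewrite /= in_itv /= => /andP[u0 u1].
have [n un] : exists n, u < F n.
  have [n _ h] := cvgr_gt 1 F_cvg u u1.
  by exists n; exact: (h n (leqnn n)).
have [|k uk kmin] := @ex_minnP (fun n => u < F n); first by exists n.
case: k uk kmin => [|k] uk kmin.
  by move: uk; rewrite /F big_ord0 ltNge u0.
exists k; rewrite /J /= in_itv /= uk andbT leNgt.
by apply/negP => /kmin; rewrite ltnn.
Qed.

Let J_inj k l u : J k u -> J l u -> k = l.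
Proof.
rewrite /J /= !in_itv /= => /andP[k1 k2] /andP[l1 l2].
case: (ltngtP k l) => // h; exfalso.
  by have := lt_le_trans k2 (le_trans (F_le h) l1); rewrite ltxx.
by have := lt_le_trans l2 (le_trans (F_le h) k1); rewrite ltxx.
Qed.

Let idxP u k : J k u -> idx u = k.
Proof.
move=> Jk; apply: (@J_inj _ _ u) => //.
by apply: (@xgetPex _ 0%N [set k | J k u]); exists k.
Qed.

Let J01 k : J k `<=` I01.
Proof.
move=> u; rewrite /J /= !in_itv /= => /andP[a b]; apply/andP; split.
  by apply: le_trans a; apply: le_trans (F_le (leq0n k)); rewrite /F big_ord0.
exact: lt_le_trans b (F_le1 _).
Qed.

Let idxE k : idx @^-1` [set k] =
  if k is 0%N then J 0%N `|` ~` (\bigcup_l J l) else J k.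
Proof.
have idx_n u : ~ (\bigcup_l J l) u -> idx u = 0%N.
  by move=> h; apply: xgetPN => l Jl; apply: h; exists l.
have idx_J u l : idx u = l -> (\bigcup_l J l) u -> J l u.
  by move=> <- [m _ Jm]; rewrite (idxP Jm).
apply/seteqP; case: k => [|k]; split => u /=.
- move=> h; have [Ju|nJ] := pselect ((\bigcup_l J l) u); last by right.
  by left; exact: idx_J.
- by case=> [/idxP//|/idx_n].
- move=> h; have [Ju|/idx_n] := pselect ((\bigcup_l J l) u); last by rewrite h.
  exact: idx_J.
- exact: idxP.
Qed.

Let measurable_idx (B : set nat) : measurable (idx @^-1` B : set R).
Proof.
have -> : idx @^-1` B = \bigcup_(k in B) idx @^-1` [set k].
  apply/seteqP; split => u /=; first by move=> Bu; exists (idx u).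
  by move=> [k Bk /= ->].
apply: bigcup_measurable => k _; rewrite idxE; case: k => [|k]; last first.
  exact: measurable_itv.
apply: measurableU; first exact: measurable_itv.
by apply: measurableC; apply: bigcup_measurable => l _; exact: measurable_itv.
Qed.

Let measurable_g k : measurable_fun setT (g k).
Proof.
rewrite /g; apply: measurable_funM; last exact: measurable_cst.
by apply: measurable_funB; [exact: measurable_id|exact: measurable_cst].
Qed.

Let measurable_res : measurable_fun setT res.
Proof.
move=> _ A mA; rewrite setTI.
have -> : res @^-1` A = \bigcup_k (idx @^-1` [set k] `&` g k @^-1` A).
  apply/seteqP; split => u /=; first by move=> Au; exists (idx u).
  by move=> [k _ [<-]].
apply: bigcup_measurable => k _; apply: measurableI; first exact: measurable_idx.
by rewrite -[X in measurable X]setTI; exact: measurable_g.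
Qed.

Let P01 : set (measurableTypeR R) -> \bar R :=
  mrestr lam (measurable_itv `[0, 1[).
HB.instance Definition _ := Measure.on P01.

Let P01T : P01 setT = 1%E.
Proof.
by rewrite /P01 /mrestr setTI lebesgue_measure_itv /= lte_fin ltr01 oppr0 adde0.
Qed.

HB.instance Definition _ := Measure_isProbability.Build _ _ _ P01 P01T.

Let lam_g k (A : set R) : 0 < p k -> measurable A ->
  lam (g k @^-1` A) = ((p k)%:E * lam A)%E.
Proof.
move=> pk mA.
have pVk : 0 <= (p k)^-1 by rewrite invr_ge0 ltW.
have mg : measurable_fun setT (g k : measurableTypeR R -> measurableTypeR R).
  exact: measurable_g.
pose m0 := measure_function_pushforward__canonical__measure_function_Measure
  lam mg.
pose m : {measure set (measurableTypeR R) -> \bar R} := mscale (NngNum pVk) m0.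
have mE B : m B = ((p k)^-1%:E * lam (g k @^-1` B))%E by [].
have -> : lam A = m A.
  apply: lebesgue_measure_unique mA => _ [[a b] _ <-]; rewrite mE /=.
  have -> : g k @^-1` `]a, b] = `]p k * a + F k, p k * b + F k]%classic.
    apply/seteqP; split => u /=; rewrite !in_itv /= /g;
      by rewrite ltr_pdivlMr // ler_pdivrMr // ltrBrDr lerBlDr !(mulrC (p k)).
  rewrite !lebesgue_measure_itv /= !lte_fin ltrD2r ltr_pM2l //.
  case: ifP => _; last by rewrite mule0.
  rewrite -!EFinD -EFinM; congr EFin.
  by rewrite opprD addrACA subrr addr0 -mulrBr mulKf // gt_eqF.
by rewrite mE muleA -EFinM mulfV ?mul1e // gt_eqF.
Qed.

Let P01_idx_g k (A : set R) : measurable A ->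
  P01 (idx @^-1` [set k] `&` g k @^-1` A) = ((p k)%:E * P01 A)%E.
Proof.
move=> mA; rewrite /P01 /mrestr.
have -> : idx @^-1` [set k] `&` g k @^-1` A `&` I01 = J k `&` g k @^-1` A.
  apply/seteqP; split => [u [[/= iu gu] Iu]|u [Jk gu]].
    by split => //; have [l Jl] := Jex Iu; rewrite -iu (idxP Jl).
  by split; [split => //=; exact: idxP|exact: J01 Jk].
have := p_ge0 k; rewrite le_eqVlt => /predU1P[pk|pk].
  rewrite -pk mul0e (_ : _ `&` _ = set0) ?measure0 //.
  apply/seteqP; split => u //= -[]; rewrite /J /= in_itv /= FS -pk addr0.
  by move=> /andP[/le_lt_trans h /h]; rewrite ltxx.
rewrite -lam_g //; last exact: measurableI.
congr (lam _); rewrite setIC; congr (_ `&` _).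
apply/seteqP; split => u /=; rewrite /J /= !in_itv /= FS /g;
  by rewrite ler_pdivlMr // mul0r subr_ge0 ltr_pdivrMr // mul1r ltrBlDl.
Qed.

Let P01_fin (A : set R) : measurable A -> P01 A \is a fin_num.
Proof. by move=> mA; apply: (@fin_num_measure _ _ _ P01). Qed.

Let P01_idx k : P01 (idx @^-1` [set k]) = (p k)%:E.
Proof.
have := @P01_idx_g k setT measurableT.
by rewrite preimage_setT setIT P01T mule1.
Qed.

Let P01_idx_res (B : set nat) (A : set R) : measurable A ->
  P01 (idx @^-1` B `&` res @^-1` A) = (P01 (idx @^-1` B) * P01 A)%E.
Proof.
move=> mA.
have bigJ (C : nat -> set R) : (forall k, measurable (C k)) ->
    P01 (\bigcup_(k in B) (idx @^-1` [set k] `&` C k)) =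
    (\sum_(k <oo | k \in B) P01 (idx @^-1` [set k] `&` C k))%E.
  move=> mC; apply: measure_bigcup.
    move=> k _; apply: measurableI; last exact: mC.
    exact: (measurable_idx [set k]).
  by move=> k l _ _ [u [[/= <- _] [/= <- _]]].
have mgA k : measurable (g k @^-1` A).
  by rewrite -[X in measurable X]setTI; exact: measurable_g.
have -> : idx @^-1` B `&` res @^-1` A =
    \bigcup_(k in B) (idx @^-1` [set k] `&` g k @^-1` A).
  apply/seteqP; split => u /=; first by move=> [Bu Au]; exists (idx u).
  by move=> [k Bk [/= iu Au]]; rewrite /res iu.
have -> : idx @^-1` B = \bigcup_(k in B) (idx @^-1` [set k] `&` setT).
  apply/seteqP; split => u /=; first by move=> Bu; exists (idx u).
  by move=> [k Bk [/= ->]].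
rewrite (bigJ _ mgA) (bigJ (fun=> setT)); last by move=> _; exact: measurableT.
rewrite -[P01 A]fineK ?P01_fin // muleC -nneseriesZl //.
apply: eq_eseriesr => k _.
by rewrite setIT P01_idx P01_idx_g // fineK ?P01_fin // muleC.
Qed.

Let Y i u : nat := idx (iter i res u).

Let measurable_iter i (A : set R) : measurable A ->
  measurable (iter i res @^-1` A).
Proof.
elim: i A => [|i ih] A mA //.
have -> : iter i.+1 res @^-1` A = iter i res @^-1` (res @^-1` A) by [].
by apply: ih; rewrite -[X in measurable X]setTI; exact: measurable_res.
Qed.

Let P01_res (A : set R) : measurable A -> P01 (res @^-1` A) = P01 A.
Proof.
move=> mA; have := @P01_idx_res setT A mA.
by rewrite !preimage_setT setTI P01T mul1e.
Qed.

Let P01_Y i (B : set nat) : P01 (Y i @^-1` B) = P01 (idx @^-1` B).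
Proof.
elim: i => // i <-.
rewrite -(P01_res (measurable_iter i (measurable_idx B))).
by congr (P01 _); apply/seteqP; split => u; rewrite /Y /= -iterSr.
Qed.

Let joint n (B : nat -> set nat) : set R :=
  [set u | forall i, (i < n)%N -> B i (Y i u)].

Let measurable_joint n B : measurable (joint n B).
Proof.
have -> : joint n B = \bigcap_(i in [set i | (i < n)%N]) (Y i @^-1` B i) by [].
apply: bigcap_measurableType => i _.
exact: (measurable_iter i (measurable_idx (B i))).
Qed.

Let P01_joint n B : P01 (joint n B) = (\prod_(i < n) P01 (idx @^-1` B i))%E.
Proof.
elim: n B => [|n ih] B.
  by rewrite big_ord0 -P01T; congr (P01 _); apply/seteqP; split.
rewrite big_ord_recl -(ih (B \o S)) -P01_idx_res; last exact: measurable_joint.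
congr (P01 _); apply/seteqP; split => u /=.
  move=> h; split; first exact: (h 0%N).
  by move=> i ni /=; rewrite /Y -iterSr; exact: (h i.+1).
move=> [B0 h] [|i] // ni; rewrite /Y iterSr; exact: h.
Qed.

Let X (i : nat) (u : R) : int := if Y i u is k.+1 then k.+1%:Z else - i.+1%:Z.
Let col (i k : nat) : int := if k is l.+1 then l.+1%:Z else - i.+1%:Z.

Let X_pre i (A : set int) : X i @^-1` A = Y i @^-1` (col i @^-1` A).
Proof. by []. Qed.

Let measurable_X i (A : set int) : measurable (X i @^-1` A : set R).
Proof. exact: (measurable_iter i (measurable_idx (col i @^-1` A))). Qed.

Let X_indep (s : seq nat) (A : nat -> set int) : uniq s ->
  P01 (\bigcap_(i in [set` s]) X i @^-1` A i) =
  (\prod_(i <- s) P01 (X i @^-1` A i))%E.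
Proof.
move=> us; pose n := (\max_(i <- s) i).+1.
have sn i : i \in s -> (i < n)%N by move=> si; rewrite ltnS; exact: leq_bigmax_seq.
pose B i : set nat := if i \in s then col i @^-1` A i else setT.
have -> : \bigcap_(i in [set` s]) X i @^-1` A i = joint n B.
  apply/seteqP; split => u /= h i.
    by move=> _; rewrite /B; case: ifP => // si; exact: (h i si).
  by move=> si; have := h i (sn _ si); rewrite /B si.
rewrite P01_joint.
have ps : perm_eq s [seq i <- iota 0 n | i \in s].
  apply: uniq_perm => //; first by rewrite filter_uniq // iota_uniq.
  move=> i; rewrite mem_filter mem_iota /= add0n.
  by case si: (i \in s) => //=; rewrite sn.
rewrite [RHS](perm_big _ ps) big_filter [RHS]big_mkcond /=.
rewrite -(big_mkord xpredT (fun i => P01 (idx @^-1` B i))) /index_iota subn0.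
apply: eq_bigr => i _; rewrite /B; case: ifP => _; first by rewrite X_pre P01_Y.
by rewrite preimage_setT P01T.
Qed.

Let ptn_of_colors (u : R) : ptn nat := pullback (X^~ u) (ptn0 int).

Let measurable_color :
  measurable_fun setT (ptn_of_colors : measurableTypeR R -> ptn nat).
Proof.
apply: measurable_fun_ptn => i j.
have -> : [set u | ptn_of_colors u i j] =
    \bigcup_k (X i @^-1` [set col i k] `&` X j @^-1` [set col i k]).
  apply/seteqP; split => u /=; first by move=> /eqP e; exists (Y i u).
  by move=> [k _ [/= -> ->]].
apply: bigcup_measurable => k _; apply: measurableI; exact: measurable_X.
Qed.

Lemma paintbox_exists : exists mu, paintbox_law x mu.
Proof.
pose f : {mfun measurableTypeR R >-> ptn nat} :=
  HB.pack (ptn_of_colors : measurableTypeR R -> ptn nat)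
  (isMeasurableFun.Build _ _ _ _ _ measurable_color).
exists (distribution P01 f), _, (measurableTypeR R), P01, X; split => //.
- move=> i k; transitivity (P01 (Y i @^-1` (col i @^-1` [set k.+1%:Z]))) => //.
  rewrite P01_Y (_ : col i @^-1` _ = [set k.+1]) ?P01_idx //.
  by apply/seteqP; split => -[|l] //= [->].
- move=> i; transitivity (P01 (Y i @^-1` (col i @^-1` [set - i.+1%:Z]))) => //.
  rewrite P01_Y (_ : col i @^-1` _ = [set 0%N]) ?P01_idx //.
  by apply/seteqP; split => -[|l].
Qed.

End PaintboxExists.

Definition paintbox (R : realType) (x : mass_ptn R) : probability (ptn nat) R :=
  projT1 (cid (paintbox_exists x)).

Lemma paintboxP (R : realType) (x : mass_ptn R) : paintbox_law x (paintbox x).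
Proof. exact: projT2 (cid (paintbox_exists x)). Qed.

(* The partition with blocks {n} and its complement. *)
Definition eps1 (n : nat) : ptn nat := pullback (pred1 n) (ptn0 bool).

(* The partition whose only non-singleton block is {i, j}. *)
Definition eps2 (i j : nat) : ptn nat :=
  pullback (fun k => if k == j then i else k) (ptn0 nat).

Section Characteristics.
Variable R : realType.
Local Open Scope ereal_scope.

Definition erosion (A : set (ptn nat)) : \bar R :=
  \sum_(0 <= n <oo) \d_(eps1 n) A.

Definition kingman (A : set (ptn nat)) : \bar R :=
  \sum_(0 <= j <oo) \sum_(i < j) \d_(eps2 i j) A.

Definition paintbox_mix (nu : {measure set (mass_ptn R) -> \bar R})
    (A : set (ptn nat)) : \bar R :=
  \int[nu]_x paintbox x A.

Record characteristics := Characteristics {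
  ck : R;
  nuCoag : {measure set (mass_ptn R) -> \bar R};
  ce : R;
  nuDisl : {measure set (mass_ptn R) -> \bar R};
  ck_ge0 : (0 <= ck)%R;
  ce_ge0 : (0 <= ce)%R;
  nuCoag_0 : nuCoag [set x | forall i, x i = 0%R] = 0;
  nuCoag_int : \int[nuCoag]_x (\sum_(0 <= i <oo) ((x i) ^+ 2)%:E) < +oo;
  nuDisl_1 : nuDisl [set x | x 0%N = 1%R /\ forall i, x i.+1 = 0%R] = 0;
  nuDisl_int :
    \int[nuDisl]_x (1 - \sum_(0 <= i <oo) ((x i) ^+ 2)%:E) < +oo }.

Definition coag_measure (chi : characteristics) (A : set (ptn nat)) : \bar R :=
  (ck chi)%:E * kingman A + paintbox_mix (nuCoag chi) A.

Definition frag_measure (chi : characteristics) (A : set (ptn nat)) : \bar R :=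
  (ce chi)%:E * erosion A + paintbox_mix (nuDisl chi) A.

End Characteristics.

Definition coag_or_frag (n : nat) (r r' : ptn 'I_n) : Prop :=
  (exists s : ptn 'I_(nblocks r), r' = coag s) \/
  (exists (k : 'I_(nblocks r)) (s : ptn 'I_#|block k|), r' = frag s).

(* Only the values q n r r' with r' != r are meaningful. *)
Definition rates (R : realType) := forall n, ptn 'I_n -> ptn 'I_n -> R.

Record has_characteristics (R : realType) (q : rates R)
    (chi : characteristics R) : Prop := HasCharacteristics {
  rate_coag : forall n (r : ptn 'I_n) (s : ptn 'I_(nblocks r)),
    s <> ptn0 _ ->
    (q n r (coag s))%:E = coag_measure chi (restr (nblocks r) @^-1` [set s]);
  rate_frag : forall n (r : ptn 'I_n) (k : 'I_(nblocks r))
      (s : ptn 'I_#|block k|),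
    s <> ptn1 _ ->
    (q n r (frag s))%:E = frag_measure chi (restr #|block k| @^-1` [set s]);
  rate_other : forall n (r r' : ptn 'I_n),
    r' <> r -> ~ coag_or_frag r r' -> q n r r' = 0 }.

Section MarkovChains.
Variables (R : realType) (S : finType).

Record transition_function (p : R -> S -> S -> R) : Prop := TransitionFunction {
  transition_ge0 : forall (t : R) i j, 0 <= t -> 0 <= p t i j;
  transition_sum : forall (t : R) i, 0 <= t -> \sum_j p t i j = 1;
  transition_0 : forall i j, p 0 i j = (i == j)%:R;
  transition_add : forall (s t : R) i j, 0 <= s -> 0 <= t ->
    p (s + t) i j = \sum_k p s i k * p t k j }.

Definition transition_rates (p : R -> S -> S -> R) (q : S -> S -> R) : Prop :=
  forall i j, i != j -> h^-1 * p h i j @[h --> 0^'+] --> q i j.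

Definition cadlag (y : R -> S) : Prop :=
  (forall t : R, 0 <= t -> \forall s \near t^'+, y s = y t) /\
  (forall t : R, 0 < t -> exists l, \forall s \near t^'-, y s = l).

End MarkovChains.

Section Processes.
Variables (R : realType) (d : measure_display) (Omega : measurableType d).
Variable P : probability Omega R.

Definition past (T : Type) (G : set (set T)) (Y : R -> Omega -> T) (t : R) :
    set (set Omega) :=
  <<s [set E | exists (u : R) A, [/\ 0 <= u <= t, G A & E = Y u @^-1` A]] >>.

Definition markov_chain (S : finType) (Y : R -> Omega -> S)
    (p : R -> S -> S -> R) : Prop :=
  forall (s t : R) (E : set Omega) i j, 0 <= s -> 0 <= t -> past setT Y s E ->
    P (E `&` Y s @^-1` [set i] `&` Y (s + t) @^-1` [set j]) =
    (P (E `&` Y s @^-1` [set i]) * (p t i j)%:E)%E.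

Local Notation kernels := (R -> R.-pker (ptn nat) ~> (ptn nat)).

Definition markov_process (X : R -> Omega -> ptn nat) (K : kernels) : Prop :=
  forall (s t : R) (E : set Omega) (A : set (ptn nat)), 0 <= s -> 0 <= t ->
    past measurable X s E -> measurable A ->
    P (E `&` X (s + t) @^-1` A) = (\int[P]_(w in E) K t (X s w) A)%E.

Record markov_semigroup (K : kernels) : Prop := MarkovSemigroup {
  semigroup_0 : forall x, K 0 x ≡μ \d_x;
  semigroup_add : forall (s t : R) x A, 0 <= s -> 0 <= t -> measurable A ->
    K (s + t) x A = (\int[K s x]_y K t y A)%E }.

Definition permute (sigma : nat -> nat) (p : ptn nat) : ptn nat :=
  pullback sigma p.

Definition finite_perm (sigma : nat -> nat) : Prop :=
  bijective sigma /\ exists N, forall n, (N <= n)%N -> sigma n = n.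

Definition exchangeable (mu : set (ptn nat) -> \bar R) : Prop :=
  forall sigma A, finite_perm sigma -> measurable A ->
    mu (permute sigma @^-1` A) = mu A.

Definition path_cylinders : set (set (R -> ptn nat)) :=
  [set E | exists (t : R) A,
    [/\ 0 <= t, measurable A & E = [set y | A (y t)]]].

Definition exchangeable_process (X : R -> Omega -> ptn nat) : Prop :=
  forall sigma E, finite_perm sigma -> <<s path_cylinders >> E ->
    P [set w | E (fun t => permute sigma (X t w))] = P [set w | E (X^~ w)].

(* X is indexed by R but only its values at nonnegative times matter; K is its
   transition semigroup, defined for every initial state, and q n are the
   transition rates of its restriction to [n]. *)
Record EFC_process (X : R -> Omega -> ptn nat) (q : rates R) (K : kernels) :
    Prop := EFCProcess {
  EFC_measurable : forall t : R, 0 <= t -> measurable_fun setT (X t);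
  EFC_exchangeable : exchangeable_process X;
  EFC_semigroup : markov_semigroup K;
  EFC_markov : markov_process X K;
  EFC_cadlag : forall n w, cadlag (fun t => restr n (X t w));
  EFC_restr : forall n, exists p : R -> ptn 'I_n -> ptn 'I_n -> R,
    [/\ transition_function p,
        transition_rates p (q n),
        markov_chain (fun t w => restr n (X t w)) p
      & forall (t : R) x r, 0 <= t ->
          K t x (restr n @^-1` [set r]) = (p t (restr n x) r)%:E];
  EFC_rates : forall n (r r' : ptn 'I_n),
    r' <> r -> ~ coag_or_frag r r' -> q n r r' = 0 }.

Definition stationary (K : kernels) (rho : probability (ptn nat) R) : Prop :=
  forall (t : R) A, 0 <= t -> measurable A -> (\int[rho]_x K t x A)%E = rho A.

Definition cvg_in_distribution (X : R -> Omega -> ptn nat)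
    (rho : probability (ptn nat) R) : Prop :=
  forall f : ptn nat -> R, continuous f -> (exists M : R, forall x, `|f x| <= M) ->
    (\int[P]_w (f (X t w))%:E)%E @[t --> +oo] --> (\int[rho]_x (f x)%:E)%E.

End Processes.

(* Main.v *)
Require Import Defs.
From HB Require Import structures.
From mathcomp Require Import all_boot all_order all_algebra.
From mathcomp Require Import all_classical all_reals all_analysis.
From mathcomp Require Import measurable_realfun giry.
From mathcomp Require Import lra.
Set Implicit Arguments.
Unset Strict Implicit.
Unset Printing Implicit Defensive.
Import Order.TTheory GRing.Theory Num.Theory numFieldNormedType.Exports.
Local Open Scope classical_set_scope.
Local Open Scope ring_scope.

(** Everything is read off the restrictions to [n], which are finite Markov
    chains, and off the compactness of the space of partitions.

    Suppose first that coalescence is present.  Then every state of the chain on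
    [n] with at least two blocks jumps at positive rate to a state with strictly
    fewer blocks: Kingman coalescence merges two given blocks, and a nonzero
    nuCoag charges the set where x_1 > 0, so that with positive mass all blocks
    have the first colour and merge at once ([coag_jump]).  Hence the one-block
    state is reached from everywhere.  If there is no coalescence then there is
    fragmentation, and symmetrically the partition into singletons is reached from
    everywhere ([frag_jump]): erosion isolates a point of a block, and nuDisl
    charges either the set where x_2 > 0, on which two colours occur, or the set
    where x_2 = 0 and x_1 < 1, on which there is dust.

    A state that is reached from everywhere within one and the same time with
    positive probability makes the transition probabilities forget the initial
    state exponentially fast (Doeblin's argument, [doeblin_osc]), so the chain on
    [n] converges to a law pi_n, which is its only stationary law ([chain_cvg],
    [converges_stationary], [converges_stationary_unique]).

    The laws pi_n are consistent, as limits of the marginals of the transition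
    laws on partitions of the integers.  By compactness a finitely additive
    function on cylinders is countably additive, so the pi_n are the marginals
    of a probability rho ([probability_extension]).  Probabilities are determined
    by cylinders, hence stationarity and uniqueness pass from the chains to rho.
    Convergence on cylinders is convergence in distribution, because continuous
    functions on a compact space are uniform limits of functions of a
    restriction ([cvg_in_distribution_cylinders]).  The law of the process at each
    time is exchangeable, and so is its limit rho.

    Finally rho is the Dirac mass at a partition x exactly when each restriction
    of x is absorbing ([invariant_law_diracP]): absorption passes to the limit,
    and conversely a stationary point mass can have no outgoing rate.  The
    partition into singletons has no block to fragment and the one-block partition
    has nothing to coalesce, so they are absorbing exactly when there is no
    coalescence, respectively no fragmentation. *)

(** * Limits of finite Markov chains *)

Lemma cvg_fsum (R : realType) (T I : Type) (F : set_system T) {FF : Filter F}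
    (r : seq I) (P : pred I) (f : I -> T -> R) (a : I -> R) :
  (forall i, P i -> f i x @[x --> F] --> a i) ->
  \sum_(i <- r | P i) f i x @[x --> F] --> \sum_(i <- r | P i) a i.
Proof. by apply: cvg_big; exact: add_continuous. Qed.

Lemma cvg_near_eq (T : Type) (U : topologicalType) (F : set_system T)
    {FF : Filter F} (f g : T -> U) (l : U) :
  (\forall x \near F, f x = g x) -> f x @[x --> F] --> l -> g x @[x --> F] --> l.
Proof. by move=> fg; apply: cvg_trans; exact: near_eq_cvg. Qed.

Section FiniteChain.
Variables (R : realType) (S : finType).

Lemma avg_le (a v : S -> R) (M : R) : (forall k, 0 <= a k) ->
  \sum_k a k = 1 -> (forall k, v k <= M) -> \sum_k a k * v k <= M.
Proof.
move=> a0 a1 vM; rewrite -[leRHS]mul1r -a1 mulr_suml.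
by apply: ler_sum => k _; apply: ler_wpM2l.
Qed.

(** Splitting the mass c off the atom at j0 leaves mass 1 - c to be averaged. *)
Lemma avg_le_atom (a v : S -> R) (M : R) (j0 : S) (c : R) :
  (forall k, 0 <= a k) -> \sum_k a k = 1 -> c <= a j0 ->
  (forall k, v k <= M) -> \sum_k a k * v k <= c * v j0 + (1 - c) * M.
Proof.
move=> a0 a1 ca vM; rewrite (bigD1 j0) //=.
have : \sum_(k | k != j0) a k * v k <= \sum_(k | k != j0) a k * M.
  by apply: ler_sum => k _; apply: ler_wpM2l.
rewrite -mulr_suml.
have -> : \sum_(k | k != j0) a k = 1 - a j0.
  by rewrite -a1 [in RHS](bigD1 j0) //= addrAC subrr add0r.
have : 0 <= (a j0 - c) * (M - v j0) by rewrite mulr_ge0 // subr_ge0.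
lra.
Qed.

(** Two laws that share an atom of mass c at j0 can be coupled to agree with
    probability c, so averaging against them shrinks oscillations by 1 - c. *)
Lemma avg_osc (a b v : S -> R) (D : R) (j0 : S) (c : R) :
  (forall k, 0 <= a k) -> \sum_k a k = 1 -> c <= a j0 ->
  (forall k, 0 <= b k) -> \sum_k b k = 1 -> c <= b j0 ->
  c <= 1 -> (forall k l, v k - v l <= D) ->
  \sum_k a k * v k - \sum_k b k * v k <= (1 - c) * D.
Proof.
move=> a0 a1 ca b0 b1 cb c1 vD.
pose M := v [arg max_(k > j0) v k]%O; pose m := v [arg min_(k < j0) v k]%O.
have vM k : v k <= M by rewrite /M; case: arg_maxP => // i _; apply.
have mv k : m <= v k by rewrite /m; case: arg_minP => // i _; apply.
have up := avg_le_atom a0 a1 ca vM.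
have dn : \sum_k b k * - v k <= c * - v j0 + (1 - c) * - m.
  by apply: (@avg_le_atom b (fun k => - v k)) => //; move=> k; rewrite lerN2.
have E : \sum_k b k * - v k = - \sum_k b k * v k.
  by rewrite -sumrN; apply: eq_bigr => k _; rewrite mulrN.
have : (1 - c) * (M - m) <= (1 - c) * D.
  by apply: ler_wpM2l; [rewrite subr_ge0|exact: vD].
rewrite E in dn; lra.
Qed.

Variable (p : R -> S -> S -> R).
Hypothesis ptf : transition_function p.

(** The limit does not depend on the initial state. *)
Definition converges_to (pi : S -> R) :=
  forall i j, p t i j @[t --> +oo] --> pi j.

Section Doeblin.
Variables (T : R) (j0 : S) (c : R).
Hypotheses (T0 : 0 <= T) (c0 : 0 < c) (c1 : c <= 1) (pT : forall i, c <= p T i j0).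

(** Each period T contracts the oscillation of the initial state by 1 - c. *)
Lemma doeblin_osc (n : nat) (j k l : S) :
  p (n%:R * T) k j - p (n%:R * T) l j <= (1 - c) ^+ n.
Proof.
elim: n k l => [|n ih] k l.
  rewrite mul0r expr0 !(transition_0 ptf).
  by case: (k == j); case: (l == j); rewrite /=; lra.
have nT : 0 <= n%:R * T by rewrite mulr_ge0.
rewrite -addn1 addnC natrD mulrDl mul1r !(transition_add ptf) // exprD expr1.
apply: (@avg_osc _ _ _ _ j0) => //; [move=> s; exact: (transition_ge0 ptf)| |
  move=> s; exact: (transition_ge0 ptf)|]; exact: (transition_sum ptf).
Qed.

(** After the time n T the transition probabilities only move inside the convex
    hull of their values at time n T, which is what makes them Cauchy. *)
Lemma doeblin_near (n : nat) (u : R) (i k j : S) : n%:R * T <= u ->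
  `|p (n%:R * T) k j - p u i j| <= (1 - c) ^+ n.
Proof.
move=> nu; have s0 : 0 <= u - n%:R * T by rewrite subr_ge0.
have nT : 0 <= n%:R * T by rewrite mulr_ge0.
pose v l := p (n%:R * T) l j - p (n%:R * T) k j.
have E : p u i j - p (n%:R * T) k j = \sum_l p (u - n%:R * T) i l * v l.
  under eq_bigr do rewrite mulrBr.
  rewrite sumrB -mulr_suml (transition_sum ptf i s0) mul1r.
  by rewrite -(transition_add ptf) // subrK.
have h1 : p u i j - p (n%:R * T) k j <= (1 - c) ^+ n.
  rewrite E; apply: avg_le => [l||l]; [exact: (transition_ge0 ptf)|
    exact: (transition_sum ptf)|exact: doeblin_osc].
have h2 : - (p u i j - p (n%:R * T) k j) <= (1 - c) ^+ n.
  rewrite E -sumrN; under eq_bigr do rewrite -mulrN.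
  apply: (@avg_le _ (fun l => - v l)) => [l||l]; [exact: (transition_ge0 ptf)|
    exact: (transition_sum ptf)|].
  by rewrite /v opprB; exact: doeblin_osc.
by rewrite ler_norml; apply/andP; split; lra.
Qed.

Lemma doeblin_cvg : exists pi, converges_to pi.
Proof.
have c01 : `|1 - c| < 1 by rewrite ger0_norm ?subr_ge0 // ltrBlDr ltrDl.
have small e : 0 < e -> exists n, (1 - c) ^+ n < e.
  move=> e0; have [n _ h] := cvgr_lt 0 (cvg_expr c01) e e0.
  by exists n; apply: h => /=.
have cv i j : cvg (p t i j @[t --> +oo]).
  apply: cauchy_cvg; apply: cauchy_exP => e e0.
  have [n ne] := small _ e0; exists (p (n%:R * T) i j).
  suff : \forall u \near +oo, ball (p (n%:R * T) i j) e (p u i j) by [].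
  near=> u; rewrite -ball_normE /=; apply: le_lt_trans ne; apply: doeblin_near.
  by near: u; apply: nbhs_pinfty_ge; rewrite num_real.
exists (fun j => lim (p t j0 j @[t --> +oo])) => i j.
apply/cvgrPdist_le => e e0; have e2 : 0 < e / 3 by rewrite divr_gt0.
have [n ne] := small _ e2.
have /cvgrPdist_le/(_ _ e2) lim_near : cvg (p t j0 j @[t --> +oo]) by [].
near=> u.
have h1 : `|lim (p t j0 j @[t --> +oo]) - p u j0 j| <= e / 3 by near: u.
have nu : n%:R * T <= u by near: u; apply: nbhs_pinfty_ge; rewrite num_real.
have h2 := doeblin_near j0 j0 j nu; have h3 := doeblin_near i j0 j nu.
rewrite distrC in h2.
have := ler_distD (p u j0 j) (lim (p t j0 j @[t --> +oo])) (p u i j).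
have := ler_distD (p (n%:R * T) j0 j) (p u j0 j) (p u i j).
lra.
Unshelve. all: by end_near. Qed.

End Doeblin.

(** The rank f strictly decreases along suitable jumps until j0 is hit, so j0 is
    reached in at most [f i] jumps.  Taking steps of one small enough length h, at
    which the chain makes any prescribed jump of positive rate or stays put with
    positive probability, one waits in j0 so as to use the same total time from
    every initial state. *)
Lemma chain_positive (q : S -> S -> R) (f : S -> nat) (j0 : S) :
  transition_rates p q ->
  (forall i, i != j0 -> exists2 j, (f j < f i)%N & 0 < q i j) ->
  exists2 T, 0 <= T & forall i, 0 < p T i j0.
Proof.
move=> pq fq.
have near_pos i j : i != j -> 0 < q i j -> \forall h \near 0^'+, 0 < p h i j.
  move=> ij qij; near=> h.
  have h0 : 0 < h by near: h; exact: nbhs_right_gt.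
  have : 0 < h^-1 * p h i j by near: h; exact: (cvgr_gt _ (pq _ _ ij)).
  by rewrite pmulr_rgt0 // invr_gt0.
have near_diag i : \forall h \near 0^'+, 0 < p h i i.
  have cv0 : (\sum_(j | j != i) p h i j) @[h --> 0^'+] --> \sum_(j : S | j != i) (0 : R).
    apply: cvg_fsum => j; rewrite eq_sym => ij.
    suff : p h i j @[h --> 0^'+] --> 0 * q i j by rewrite mul0r.
    have cvh : h * (h^-1 * p h i j) @[h --> 0^'+] --> 0 * q i j.
      by apply: cvgM (pq _ _ ij); exact: cvg_at_right_filter cvg_id.
    apply: (cvg_near_eq _ cvh); near=> h.
    have h0 : 0 < h by near: h; exact: nbhs_right_gt.
    by rewrite mulrA divff ?mul1r // gt_eqF.
  rewrite big1 // in cv0; near=> h.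
  have h0 : 0 <= h by near: h; exact: nbhs_right_ge.
  have : \sum_(j | j != i) p h i j < 1 by near: h; exact: (cvgr_lt _ cv0).
  by rewrite -(transition_sum ptf i h0) [ltRHS](bigD1 i) //= ltrDr.
(* finitely many conditions hold for all small h, hence at a common h *)
have [h h0 [edge diag]] : exists2 h, 0 < h &
    (forall i j, i != j -> 0 < q i j -> 0 < p h i j) /\ (forall i, 0 < p h i i).
  have N1 : \forall h \near 0^'+, forall i j, i != j -> 0 < q i j -> 0 < p h i j.
    apply: filter_forall => i; apply: filter_forall => j.
    have [ij|ij] := boolP (i != j); last by near=> h.
    have [qij|qij] := boolP (0 < q i j); last by near=> h.
    by near=> h => _ _; near: h; exact: near_pos.
  have N2 : \forall h \near 0^'+, forall i, 0 < p h i i.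
    by apply: filter_forall => i.
  near ((0 : R)^'+) => h; exists h; first by near: h; exact: nbhs_right_gt.
  by split; near: h.
have step n i j : 0 < p h i j -> 0 < p (n%:R * h) j j0 -> 0 < p (n.+1%:R * h) i j0.
  move=> h1 h2; have nh : 0 <= n%:R * h by rewrite mulr_ge0 // ltW.
  rewrite -add1n natrD mulrDl mul1r (transition_add ptf) ?(ltW h0) //.
  rewrite (bigD1 j) //= ltr_wpDr ?mulr_gt0 //; apply: sumr_ge0 => k _.
  by rewrite mulr_ge0 ?(transition_ge0 ptf) // ltW.
have stay n : 0 < p (n%:R * h) j0 j0.
  elim: n => [|n ih]; first by rewrite mul0r (transition_0 ptf) eqxx.
  exact: step ih.
have reach n i : (f i <= n)%N -> 0 < p (n%:R * h) i j0.
  elim: n i => [|n ih] i fi; have [->//|ij0] := eqVneq i j0.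
    by have [j] := fq _ ij0; rewrite ltnNge (leq_trans fi).
  have [j fj qij] := fq _ ij0.
  have ij : i != j by apply: contraTneq fj => ->; rewrite ltnn.
  by apply: (step _ _ j); [exact: edge|apply: ih; rewrite -ltnS (leq_trans fj)].
exists ((\max_i f i)%N%:R * h) => [|i]; first by rewrite mulr_ge0 // ltW.
by apply: reach; exact: leq_bigmax.
Unshelve. all: by end_near. Qed.

Lemma chain_cvg (q : S -> S -> R) (f : S -> nat) (j0 : S) :
  transition_rates p q ->
  (forall i, i != j0 -> exists2 j, (f j < f i)%N & 0 < q i j) ->
  exists pi, converges_to pi.
Proof.
move=> pq fq; have [T T0 pT] := chain_positive pq fq.
pose i1 := [arg min_(i < j0) p T i j0]%O.
have i1P i : p T i1 j0 <= p T i j0 by rewrite /i1; case: arg_minP => // k _; apply.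
apply: (@doeblin_cvg T j0 (p T i1 j0)) => //.
rewrite -(transition_sum ptf i1 T0) (bigD1 j0) //= lerDl.
by apply: sumr_ge0 => k _; apply: (transition_ge0 ptf).
Qed.

Definition chain_stationary (pi : S -> R) :=
  forall t j, 0 <= t -> \sum_i pi i * p t i j = pi j.

Lemma converges_stationary (pi : S -> R) (i0 : S) : converges_to pi ->
  chain_stationary pi.
Proof.
move=> cv t j t0.
have c1 : (\sum_i p s i0 i * p t i j) @[s --> +oo] --> \sum_i pi i * p t i j.
  by apply: cvg_fsum => i _; apply: cvgM; [exact: cv|exact: cvg_cst].
have c2 : p (s + t) i0 j @[s --> +oo] --> pi j.
  apply: (@cvg_comp _ _ _ (fun s => s + t) (fun u => p u i0 j) _ +oo); last exact: cv.
  move=> A [M [_ MA]]; exists (M - t); split; first exact: num_real.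
  by move=> x /=; rewrite ltrBlDr; exact: MA.
apply: (cvg_unique _ c1) => //; apply: cvg_near_eq c2; near=> s.
by rewrite (transition_add ptf).
Unshelve. all: by end_near. Qed.

Lemma converges_stationary_unique (pi pi' : S -> R) : converges_to pi ->
  \sum_i pi' i = 1 -> chain_stationary pi' -> pi' =1 pi.
Proof.
move=> cv s1 st j.
have c1 : (\sum_i pi' i * p s i j) @[s --> +oo] --> \sum_i pi' i * pi j.
  by apply: cvg_fsum => i _; apply: cvgM; [exact: cvg_cst|exact: cv].
rewrite -mulr_suml s1 mul1r in c1.
apply: (cvg_unique _ _ c1) => //; apply: cvg_near_eq (cvg_cst (pi' j)).
by near=> s; rewrite st.
Unshelve. all: by end_near. Qed.

(** Over n steps of length t / n the chain leaves j0 with probability at most n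
    times the one of a single step (Bernoulli), and this bound tends to t times
    the total rate out of j0, which vanishes. *)
Lemma absorbing (q : S -> S -> R) (j0 : S) : transition_rates p q ->
  (forall j, j != j0 -> q j0 j = 0) -> forall t, 0 <= t -> p t j0 j0 = 1.
Proof.
move=> pq q0 t; rewrite le_eqVlt => /predU1P[<-|t0].
  by rewrite (transition_0 ptf) eqxx.
have p0 h : 0 <= h -> forall i j, 0 <= p h i j by move=> ? ? ?; apply: (transition_ge0 ptf).
have p1 h : 0 <= h -> p h j0 j0 = 1 - \sum_(j | j != j0) p h j0 j.
  by move=> h0; rewrite -(transition_sum ptf j0 h0) (bigD1 j0) //= addrK.
apply: le_anti; rewrite p1 ?(ltW t0) // gerBl ?sumr_ge0 //=; last first.
  by move=> j _; rewrite p0 // ltW.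
rewrite -p1 ?(ltW t0) //.
have bern n h : 0 <= h -> 1 - n%:R * (\sum_(j | j != j0) p h j0 j) <= p (n%:R * h) j0 j0.
  move=> h0; elim: n => [|n ih].
    by rewrite !mul0r subr0 (transition_0 ptf) eqxx.
  have nh : 0 <= n%:R * h by rewrite mulr_ge0.
  rewrite -add1n natrD [in leRHS]mulrDl mul1r (transition_add ptf) //.
  apply: (@le_trans _ _ (p h j0 j0 * p (n%:R * h) j0 j0)); last first.
    by rewrite [leRHS](bigD1 j0) //= lerDl sumr_ge0 // => k _; rewrite mulr_ge0 ?p0.
  have l1 : p (n%:R * h) j0 j0 <= 1.
    by rewrite p1 // gerBl sumr_ge0 // => k _; rewrite p0.
  have s0 : 0 <= \sum_(j | j != j0) p h j0 j by rewrite sumr_ge0 // => k _; rewrite p0.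
  rewrite (p1 h) //; set s := \sum_(_ | _) _ in s0 ih *.
  have : 0 <= s * (1 - p (n%:R * h) j0 j0) by rewrite mulr_ge0 // subr_ge0.
  by rewrite mulrDl mul1r; lra.
have cv0 : (\sum_(j | j != j0) h^-1 * p h j0 j) @[h --> 0^'+] -->
    \sum_(j : S | j != j0) (0 : R).
  by apply: cvg_fsum => j ij; have := pq j0 j; rewrite (q0 _ ij) eq_sym => /(_ ij).
rewrite big1 // in cv0.
have cvt : (t / n.+1%:R : R) @[n --> \oo] --> (0 : R).
  by rewrite -[0](mulr0 t); apply: cvgM; [exact: cvg_cst|exact: cvg_harmonic].
have cv1 := (cvg_at_rightP _ _ _).1 cv0 (fun n => t / n.+1%:R)
  (conj (fun n => divr_gt0 t0 (ltr0Sn R n)) cvt).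
have cv2 : 1 - t * (\sum_(j | j != j0) (t / n.+1%:R)^-1 * p (t / n.+1%:R) j0 j)
    @[n --> \oo] --> 1 - t * 0.
  by apply: cvgB; [exact: cvg_cst|apply: cvgM; [exact: cvg_cst|exact: cv1]].
rewrite mulr0 subr0 in cv2.
apply: (cvgr_to_le cv2); near=> n.
have n0 : (n.+1%:R : R) != 0 by rewrite pnatr_eq0.
have tn : 0 <= t / n.+1%:R by rewrite divr_ge0 // ltW.
have := bern n.+1 _ tn; rewrite (mulrC _ (t / _)) divfK //.
apply: le_trans.
by rewrite lerD2l lerN2 -!mulr_sumr mulrA invf_div mulrCA divff ?mulr1 ?gt_eqF.
Unshelve. all: by end_near. Qed.
End FiniteChain.

(** * The compact space of partitions of the integers *)

Section PartitionSpace.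

(** An ultrafilter decides for each pair of integers whether they are in the same
    block; these decisions form an equivalence relation, which is its limit. *)
Lemma compact_ptn : compact [set: ptn nat].
Proof.
rewrite compact_ultra => F FU _.
pose p i j := `[< F [set x : ptn nat | x i j] >].
have pE : equivalence_rel p.
  move=> i j k; split.
    by apply/asboolP; apply: filterS filterT => x _; exact: ptn_refl.
  move=> /asboolP Fij; apply/asboolP/asboolP; apply: filterS2 Fij => x /=.
    by move=> xij; rewrite (ptn_trans_eq k xij).
  by move=> xij; rewrite (ptn_trans_eq k xij).
exists (Ptn pE); split => // A [n _ nA]; apply: filterS nA _.
have Fpij i j : F [set x : ptn nat | p i j = x i j].
  rewrite /p; case: asboolP => [|nF]; first by apply: filterS => x /= ->.
  have [//|] := in_ultra_setVsetC [set x : ptn nat | x i j] FU.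
  by apply: filterS => x /= /negP/negbTE ->.
have : F [set x : ptn nat | forall i j : 'I_n, p i j = x i j].
  apply: (@filter_forall _ 'I_n (fun (i : 'I_n) (x : ptn nat) =>
    forall j : 'I_n, p i j = x i j) F) => i.
  by apply: (@filter_forall _ 'I_n (fun (j : 'I_n) (x : ptn nat) =>
    p i j = x i j) F) => j; exact: Fpij.
by apply: filterS => x /= h; apply: ptn_ext => i j /=; exact: h.
Qed.

Lemma open_restr n (B : set (ptn 'I_n)) : open (restr n @^-1` B).
Proof. by rewrite openE => p Bp; exists n => // p' /= <-. Qed.

Lemma measurable_restr n (B : set (ptn 'I_n)) : measurable (restr n @^-1` B).
Proof. by apply: sub_sigma_algebra; exact: open_restr. Qed.

Definition is_cylinder (A : set (ptn nat)) : Prop :=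
  exists n (B : set (ptn 'I_n)), A = restr n @^-1` B.

Lemma cylinder_restr n (B : set (ptn 'I_n)) : is_cylinder (restr n @^-1` B).
Proof. by exists n, B. Qed.

Lemma open_cylinder A : is_cylinder A -> open A.
Proof. by move=> [n [B ->]]; exact: open_restr. Qed.

Lemma measurable_cylinder A : is_cylinder A -> measurable A.
Proof. by move=> [n [B ->]]; exact: measurable_restr. Qed.

Lemma restr_lift m n (B : set (ptn 'I_m)) : (m <= n)%N ->
  exists B' : set (ptn 'I_n), restr m @^-1` B = restr n @^-1` B'.
Proof.
move=> mn; exists [set r | B (pullback (widen_ord mn) r)].
apply/seteqP; split => p /=; rewrite (_ : pullback _ (restr n p) = restr m p) //;
  exact: ptn_ext.
Qed.

Lemma cylinder_common A B : is_cylinder A -> is_cylinder B ->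
  exists n (A' B' : set (ptn 'I_n)), A = restr n @^-1` A' /\ B = restr n @^-1` B'.
Proof.
move=> [n [A' ->]] [m [B' ->]]; exists (maxn n m).
have [A'' ->] := restr_lift A' (leq_maxl n m).
have [B'' ->] := restr_lift B' (leq_maxr n m).
by exists A'', B''.
Qed.

Lemma cylinder0 : is_cylinder set0.
Proof. by exists 0%N, set0; rewrite preimage_set0. Qed.

Lemma cylinderT : is_cylinder setT.
Proof. by exists 0%N, setT; rewrite preimage_setT. Qed.

Lemma cylinderC : setC_closed is_cylinder.
Proof. by move=> A [n [B ->]]; exists n, (~` B); rewrite preimage_setC. Qed.

Lemma cylinderU : setU_closed is_cylinder.
Proof.
move=> A B cA cB; have [n [A' [B' [-> ->]]]] := cylinder_common cA cB.
by exists n, (A' `|` B'); rewrite preimage_setU.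
Qed.

Lemma cylinderI : setI_closed is_cylinder.
Proof.
move=> A B cA cB; have [n [A' [B' [-> ->]]]] := cylinder_common cA cB.
by exists n, (A' `&` B'); rewrite preimage_setI.
Qed.

Lemma measurable_ptnE :
  @measurable _ (ptn nat) = <<s is_cylinder >>.
Proof.
apply/seteqP; split; last first.
  by apply: smallest_sub; [exact: sigma_algebra_measurable|exact: measurable_cylinder].
apply: smallest_sub; first exact: smallest_sigma_algebra.
move=> U /open_ptn_cylinders ->.
have [_ _ sa] := smallest_sigma_algebra setT is_cylinder.
apply: sa => n; apply: sub_sigma_algebra.
exists n, [set r | restr n @^-1` [set r] `<=` U].
by apply/seteqP; split => p /=; [move=> [r rU ->]|move=> h; exists (restr n p)].
Qed.

Variable R : realType.
Local Open Scope ereal_scope.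

(** The set function m is not packaged as a measure, so that m can also be the law
    of a process at one time. *)
Lemma additive_atoms (m : set (ptn nat) -> \bar R) n (B : {pred ptn 'I_n}) :
  m set0 = 0 ->
  (forall A A', is_cylinder A -> is_cylinder A' -> A `&` A' = set0 ->
     m (A `|` A') = m A + m A') ->
  m (restr n @^-1` [set r | r \in B]) = \sum_(r in B) m (restr n @^-1` [set r]).
Proof.
move=> m0 mU.
suff H (s : seq (ptn 'I_n)) : uniq s ->
    m (restr n @^-1` [set r | r \in s]) = \sum_(r <- s) m (restr n @^-1` [set r]).
  rewrite -big_enum /= -H ?enum_uniq //; congr m.
  by apply/seteqP; split => p /=; rewrite fintype.mem_enum.
elim: s => [_|r s ih /= /andP[rs us]].
  by rewrite big_nil -m0; congr m; apply/seteqP; split.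
rewrite big_cons -ih // -mU; [|exact: cylinder_restr|exact: cylinder_restr|].
  congr m; apply/seteqP; split => p /=; rewrite inE.
    by move=> /predU1P.
  by move=> h; apply/predU1P.
by apply/seteqP; split => p //= -[-> ]; rewrite (negbTE rs).
Qed.

Lemma measure_atoms (m : {measure set (ptn nat) -> \bar R}) n (B : {pred ptn 'I_n}) :
  m (restr n @^-1` [set r | r \in B]) = \sum_(r in B) m (restr n @^-1` [set r]).
Proof.
apply: additive_atoms => // A A' cA cA' AA'.
by rewrite measureU //; exact: measurable_cylinder.
Qed.

Lemma ptn_measure_unique (m1 m2 : {measure set (ptn nat) -> \bar R}) :
  m1 setT < +oo ->
  (forall n r, m1 (restr n @^-1` [set r]) = m2 (restr n @^-1` [set r])) ->
  m1 ≡μ m2.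
Proof.
move=> m1oo E; move=> A mA.
apply: (@measure_unique _ R _ is_cylinder (fun=> setT)) => //.
- exact: measurable_ptnE.
- exact: cylinderI.
- by move=> _; exact: cylinderT.
- by apply/seteqP; split => // x _; exists 0%N.
- move=> _ [n [B ->]].
  have -> : B = [set r | r \in [pred r | `[< B r >]]].
    by apply/seteqP; split => r h; [exact/asboolP|apply/asboolP].
  by rewrite !measure_atoms; apply: eq_bigr => r _; exact: E.
Qed.

End PartitionSpace.

(** * Extension of a probability from cylinders *)

(** A copy of the space of partitions whose measurable sets are the cylinders
    only: they form an algebra of sets, on which a premeasure is extended. *)
Definition cylinder_space : Type := ptn nat.
HB.instance Definition _ := Pointed.on cylinder_space.
HB.instance Definition _ := @isAlgebraOfSets.Build default_measure_display
  cylinder_space is_cylinder cylinder0 cylinderU cylinderC.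

Section Extension.
Variables (R : realType) (nu : nat -> {measure set (ptn nat) -> \bar R}).
Hypothesis nuT : forall k, nu k setT = 1%E.
Hypothesis nu_cvg : forall A, is_cylinder A -> cvgn (fun k => nu k A).
Local Open Scope ereal_scope.

(* The maximum only serves to get a nonnegative value on sets where the limit
   does not exist. *)
Let mu (A : set cylinder_space) : \bar R := maxe 0 (limn (fun k => nu k A)).

Let muE A : is_cylinder A -> nu k A @[k --> \oo] --> mu A.
Proof.
move=> cA; rewrite /mu max_r; first exact: nu_cvg.
by apply: lime_ge; [exact: nu_cvg|exact: nearW].
Qed.

Let mu0 : mu set0 = 0.
Proof.
rewrite /mu (_ : (fun k => nu k set0) = cst 0) ?lim_cst ?maxxx //.
by apply/funext => k; rewrite measure0.
Qed.

Let mu_ge0 A : 0 <= mu A.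
Proof. by rewrite /mu le_max lexx. Qed.

Let mu_fin A : is_cylinder A -> mu A \is a fin_num.
Proof.
move=> cA; rewrite ge0_fin_numE //; apply: (@le_lt_trans _ _ 1); last exact: ltry.
apply: (cvge_le _ (muE cA)); apply: nearW => k.
rewrite -(nuT k); apply: le_measure => //; rewrite inE //.
exact: measurable_cylinder.
Qed.

Let muU A B : is_cylinder A -> is_cylinder B -> A `&` B = set0 ->
  mu (A `|` B) = mu A + mu B.
Proof.
move=> cA cB AB; apply: (cvg_unique _ (muE (cylinderU cA cB))) => //.
have -> : (fun k => nu k (A `|` B)) = (fun k => nu k A + nu k B).
  by apply/funext => k; rewrite measureU //; exact: measurable_cylinder.
apply: cvgeD; [|exact: muE|exact: muE].
by apply: fin_num_adde_defl; exact: mu_fin.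
Qed.

(* Cylinders are open and compact, so a disjoint sequence of cylinders whose union
   is a cylinder has only finitely many nonempty terms. *)
Let mu_semi_sigma_additive : semi_sigma_additive mu.
Proof.
move=> F mF tF mUF.
have cF i : is_cylinder (F i) by exact: mF.
have cUF : is_cylinder (\bigcup_n F n) by exact: mUF.
have [N NF] : exists N, forall i, (N <= i)%N -> F i = set0.
  have := compact_ptn; rewrite compact_cover.
  move=> /(_ nat setT (fun i => F i `|` ~` \bigcup_n F n)) [].
  - by move=> i _; apply: open_cylinder; apply: cylinderU => //; exact: cylinderC.
  - move=> p _; have [[i _ Fp]|nFp] := pselect ((\bigcup_n F n) p).
      by exists i => //; left.
    by exists 0%N => //; right.
  move=> D _ DF; exists (\max_(i <- finmap.enum_fset D) i).+1 => i iD.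
  apply (seteqP (F i) set0).2; split => // p Fp; have [j /= jD []] := DF p I.
    move=> Fjp; have ij : i = j by apply: (tF i j) => //; exists p.
    suff : (j < j)%N by rewrite ltnn.
    rewrite -{2}ij; apply: leq_trans iD; rewrite ltnS.
    exact: leq_bigmax_seq.
  by apply; exists i.
have cN n : is_cylinder (\big[setU/set0]_(i < n) F i).
  elim/big_rec: _ => [|i A _ cA]; first exact: cylinder0.
  exact: cylinderU.
have addN n : mu (\big[setU/set0]_(i < n) F i) = \sum_(0 <= i < n) mu (F i).
  elim: n => [|n ih]; first by rewrite big_ord0 big_geq.
  rewrite big_ord_recr big_nat_recr //= (muU (cN n) (cF n)) ?ih //.
  apply (seteqP _ set0).2; split => // p [] /=; rewrite -bigcup_mkord => -[i /= ni Fip] Fnp.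
  suff : i = n by move=> E; rewrite E ltnn in ni.
  by apply: (tF i n) => //; exists p.
apply: cvg_near_cst; exists N => // n /= Nn.
rewrite -addN; congr mu; rewrite -bigcup_mkord; apply/seteqP; split => p.
  by move=> [i _ Fip]; exists i.
move=> [i _ Fip]; exists i => //=; rewrite ltnNge; apply/negP => ni.
by move: Fip; rewrite NF // (leq_trans Nn).
Qed.

(** Pointwise convergence on cylinders suffices for a limit law to exist: no mass
    can escape from a compact space. *)
Lemma probability_extension : exists rho : probability (ptn nat) R,
  forall A, is_cylinder A -> nu k A @[k --> \oo] --> rho A.
Proof.
pose mumeas : {measure set cylinder_space -> \bar R} :=
  HB.pack mu (isMeasure.Build _ _ _ mu mu0 mu_ge0 mu_semi_sigma_additive).
pose m (A : set (ptn nat)) : \bar R := measure_extension mumeas A.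
have mE A : is_cylinder A -> m A = mu A by move=> cA; exact: measurable_mu_extE.
have m0 : m set0 = 0 by rewrite mE //; exact: cylinder0.
have m_ge0 A : 0 <= m A by exact: measure_ge0.
have ms : semi_sigma_additive m.
  move=> F mF tF mUF; apply: (@measure_semi_sigma_additive _ _ _
    (measure_extension mumeas) F) => //.
    by move=> i; have := mF i; rewrite measurable_ptnE.
  by have := mUF; rewrite measurable_ptnE.
have mT : m setT = 1.
  rewrite mE; last exact: cylinderT.
  apply: (cvg_unique _ (muE cylinderT)) => //.
  rewrite (_ : (fun k => nu k setT) = cst 1); first exact: cvg_cst.
  by apply/funext => k; exact: nuT.
pose m' : {measure set (ptn nat) -> \bar R} :=
  HB.pack m (isMeasure.Build _ _ _ m m0 m_ge0 ms).
pose rho : probability (ptn nat) R :=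
  HB.pack (m : set (ptn nat) -> \bar R) m' (Measure_isProbability.Build _ _ _ m' mT).
by exists rho => A cA; rewrite [rho A](mE _ cA); exact: muE.
Qed.

End Extension.

(** * Blocks, coagulation and fragmentation of finite partitions *)

Section FinitePartitions.
Variable n : nat.
Implicit Types r : ptn 'I_n.

Lemma leader_ex r (i : 'I_n) :
  exists l, [/\ r i l, l \in leaders r & forall j, r i j -> (l <= j)%N].
Proof.
have [l ril lmin] := arg_minnP (fun j : 'I_n => j : nat) (ptn_refl r i).
exists l; split => //; rewrite inE; apply/forallP => j; apply/implyP => rlj.
by apply: lmin; rewrite /= (ptn_trans_eq j ril).
Qed.

Lemma nblocks_le r : (nblocks r <= n)%N.
Proof. by rewrite /nblocks -[leqRHS]card_ord max_card. Qed.

(** The leaders of a coarser partition are leaders of the finer one; when two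
    blocks are merged, the larger of their leaders is lost. *)
Lemma nblocks_lt r r' (i j : 'I_n) : (forall a b, r a b -> r' a b) ->
  r' i j -> ~~ r i j -> (nblocks r' < nblocks r)%N.
Proof.
move=> rr' r'ij nrij; apply: proper_card; apply/properP; split.
  apply/fintype.subsetP => l; rewrite !inE => /forallP lP.
  by apply/forallP => k; apply/implyP => /rr' h; have /implyP := lP k; exact.
have [a [ria La _]] := leader_ex r i; have [b [rjb Lb _]] := leader_ex r j.
have r'ab : r' a b.
  by rewrite -(ptn_trans_eq b (rr' _ _ ria)) (ptn_trans_eq b r'ij) rr'.
have nL (k l : 'I_n) : r' k l -> (l < k)%N -> k \notin leaders r'.
  move=> kl lk; rewrite inE; apply/forallPn; exists l.
  by rewrite negb_imply kl -ltnNge.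
have [lt|lt|/val_inj E] := ltngtP a b.
- by exists b => //; apply: (nL _ a) => //; rewrite ptn_sym.
- by exists a => //; exact: (nL _ b).
by move: nrij; rewrite (ptn_trans_eq j ria) E ptn_sym rjb.
Qed.

Lemma neq_ptn1 r : r != ptn1 _ -> exists i j, ~~ r i j.
Proof.
move=> /eqP r1; apply: contrapT => h; apply: r1; apply: ptn_ext => i j /=.
by apply: contrapT => /negP nr; apply: h; exists i, j.
Qed.

Lemma neq_ptn0 r : r != ptn0 _ -> exists i j, i != j /\ r i j.
Proof.
move=> /eqP r1; apply: contrapT => h; apply: r1; apply: ptn_ext => i j /=.
have [->|ij] := eqVneq i j; first by rewrite ptn_refl.
by apply/negbTE/negP => rij; apply: h; exists i, j.
Qed.

Lemma coag_ptn0 r : coag (ptn0 _ : ptn 'I_(nblocks r)) = r.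
Proof. by apply: ptn_ext => i j /=; exact: bidxE. Qed.

Lemma coag_coarser r (s : ptn 'I_(nblocks r)) (i j : 'I_n) :
  r i j -> coag s i j.
Proof. by rewrite -bidxE => /eqP /= ->; exact: ptn_refl. Qed.

Lemma frag_finer r (k : 'I_(nblocks r)) (s : ptn 'I_#|block k|) (i j : 'I_n) :
  frag s i j -> r i j.
Proof. by case/andP. Qed.

Lemma frag_ptn1 r (k : 'I_(nblocks r)) : frag (ptn1 _ : ptn 'I_#|block k|) = r.
Proof.
apply: ptn_ext => i j; rewrite /= /frag_rel; case rij : (r i j) => //=.
apply/implyP => ik; have jk : j \in block k.
  by move: ik; rewrite !inE => /eqP <-; rewrite bidxE ptn_sym.
apply/existsP; exists (enum_rank_in ik i); apply/existsP.
by exists (enum_rank_in ik j); rewrite !enum_rankK_in // !eqxx.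
Qed.

Lemma frag_separates r (k : 'I_(nblocks r)) (s : ptn 'I_#|block k|)
    (a b : 'I_#|block k|) :
  ~~ s a b -> ~~ frag s (enum_val a) (enum_val b).
Proof.
apply: contra => /andP[_ /implyP/(_ (enum_valP a))].
by move=> /existsP[c /existsP[e /and3P[/eqP/enum_val_inj-> /eqP/enum_val_inj->]]].
Qed.

End FinitePartitions.

(** * Positivity of the jump rates *)

Section PaintboxBounds.
Variables (R : realType) (x : mass_ptn R).
Local Open Scope ereal_scope.

(** The first m colours are those prescribed by c with probability at least
    [a ^+ m]; colours are either a positive integer k + 1, of probability [x k], or
    - (i + 1) for the element i in the dust. *)
Lemma paintbox_ge (m : nat) (c : nat -> int) (a : R) : (0 <= a)%R ->
  (forall i, (i < m)%N -> (exists2 k, c i = k.+1%:Z & (a <= x k)%R) \/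
     (c i = (- i.+1%:Z)%R /\ a%:E <= 1 - \sum_(0 <= k <oo) (x k)%:E)) ->
  (a ^+ m)%:E <= paintbox x (restr m @^-1` [set restr m (pullback c (ptn0 int))]).
Proof.
move=> a0 ac; have [d [Om [P [X [mX ind Xk Xd law]]]]] := paintboxP x.
rewrite law; last exact: measurable_restr.
apply: (@le_trans _ _ (P (\bigcap_(i in [set` iota 0 m]) X i @^-1` [set c i]))).
  rewrite (ind _ (fun i => [set c i])) ?iota_uniq //.
  have : all (fun i => i < m)%N (iota 0 m).
    by apply/allP => i; rewrite mem_iota add0n.
  rewrite -[in X in (a ^+ X)%:E](size_iota 0 m).
  elim: (iota 0 m) => [|i s ih] /=; first by rewrite big_nil expr0.
  move=> /andP[im sm]; rewrite big_cons exprS EFinM; apply: lee_pmul.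
  - by rewrite lee_fin.
  - by rewrite lee_fin exprn_ge0.
  - by case: (ac i im) => [[k -> ax]|[-> ax]]; rewrite ?Xk ?Xd ?lee_fin.
  - exact: ih.
apply: le_measure; rewrite ?inE.
- by apply: bigcap_measurableType => i _; exact: mX.
- have mp : measurable_fun setT (fun w => pullback (X^~ w) (ptn0 int)).
    apply: measurable_fun_ptn => i j.
    rewrite (_ : [set w | _] = \bigcup_k (X i @^-1` [set k] `&` X j @^-1` [set k])).
      apply: countable_bigcupT_measurable => // k.
      by apply: measurableI; exact: mX.
    apply/seteqP; split => w /=; first by move=> /eqP E; exists (X i w).
    by move=> [k _ [/= -> ->]].
  by rewrite -[X in measurable X]setTI; apply: mp => //; exact: measurable_restr.
- move=> w h /=; apply: ptn_ext => i j /=.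
  by rewrite (h i) ?(h j) //= mem_iota add0n ltn_ord.
Qed.

End PaintboxBounds.

Lemma measurable_neq0 d (T : measurableType d) (R : realType) (g : T -> R) :
  measurable_fun setT g -> measurable [set x | g x != 0].
Proof.
move=> mg; rewrite (_ : [set x | _] = setT `&` g @^-1` (~` [set 0])).
  by apply: mg => //; exact: measurableC.
by rewrite setTI; apply/seteqP; split => x /= /eqP.
Qed.

Lemma null_setU d (T : measurableType d) (R : realType)
    (nu : {measure set T -> \bar R}) (A B : set T) :
  measurable A -> measurable B -> nu A = 0%E -> nu B = 0%E -> nu (A `|` B) = 0%E.
Proof.
move=> mA mB A0 B0; apply/(negligibleP nu (measurableU _ _ mA mB)).
by apply: negligibleU; exact/negligibleP.
Qed.

(** The integral of a nonnegative function is the supremum of the integrals of the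
    simple functions below it, hence monotone on all functions; f will be the mass
    that the paintbox of x gives to a cylinder, as a function of x. *)
Lemma null_neq0_of_integral_eq0 d (T : measurableType d) (R : realType)
    (nu : {measure set T -> \bar R}) (f : T -> \bar R) (g : T -> R) :
  measurable_fun setT g -> (forall x, 0 <= g x) ->
  (forall x, ((g x)%:E <= f x)%E) -> (\int[nu]_x f x = 0)%E ->
  nu [set x | g x != 0] = 0%E.
Proof.
move=> mg g0 gf f0.
have ge0f x : (0 <= f x)%E by apply: le_trans (gf x); rewrite lee_fin.
have g_int0 : (\int[nu]_x `|(g x)%:E| = 0)%E.
  apply/eqP; rewrite eq_le integral_ge0 // andbT -f0 !ge0_integralTE //.
  apply: ereal_sup_le => _ [h hg <-]; exists h => //= x.
  by apply: le_trans (hg x) _; rewrite gee0_abs ?lee_fin.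
have mgE : measurable_fun setT (EFin \o g) by exact/measurable_EFinP.
have mA : measurable [set x | g x != 0].
  exact: measurable_neq0.
apply/(negligibleP nu mA); apply: negligibleS ((ae_eq_integral_abs nu measurableT mgE).1 g_int0).
by move=> x /= gx h; have [] := h I; move: gx => /[swap] -> /eqP.
Qed.

Section Characteristics.
Variables (R : realType) (chi : characteristics R).
Local Open Scope ereal_scope.

Let measurable_mass i : measurable_fun setT (fun x : mass_ptn R => x i).
Proof.
move=> _ B mB; rewrite setTI; apply: sub_sigma_algebra; exists i, B => //.
Qed.

Let mass_le (x : mass_ptn R) (i j : nat) : (i <= j)%N -> (x j <= x i)%R.
Proof.
move=> /subnK <-; elim: (j - i)%N => // k ih.
by rewrite addSn; apply: le_trans ih; exact: mass_noninc.
Qed.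

Let mix_ge0 (nu : {measure set (mass_ptn R) -> \bar R}) A : 0 <= paintbox_mix nu A.
Proof. by apply: integral_ge0. Qed.

Lemma kingman_ge1 (a b : nat) A : (a < b)%N -> A (eps2 a b) -> 1 <= kingman R A.
Proof.
move=> ab Aab.
have t0 j : 0 <= \sum_(i < j) (\d_(eps2 i j) A : \bar R) by apply: sume_ge0.
apply: le_trans (nneseries_lim_ge b.+1 (fun j _ _ => t0 j)).
rewrite big_nat_recr //= (bigD1 (Ordinal ab)) //= diracE mem_set // addeCA leeDl //.
by apply: adde_ge0; apply: sume_ge0 => i _ //; exact: t0.
Qed.

Lemma erosion_ge1 (a : nat) A : A (eps1 a) -> 1 <= erosion R A.
Proof.
move=> Aa; apply: le_trans (nneseries_lim_ge a.+1 _); last by [].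
by rewrite big_nat_recr //= diracE mem_set // leeDr // sume_ge0.
Qed.

Let mix_zero (nu : {measure set (mass_ptn R) -> \bar R}) A :
  nu ≡μ mzero -> paintbox_mix nu A = 0.
Proof.
move=> nu0; rewrite /paintbox_mix (eq_measure_integral mzero).
  exact: integral_measure_zero.
by move=> B mB _; exact: nu0.
Qed.

Let mzero_setT (nu : {measure set (mass_ptn R) -> \bar R}) :
  nu setT = 0 -> nu ≡μ mzero.
Proof.
move=> nuT A mA; apply/eqP; rewrite eq_le measure_ge0 andbT.
by rewrite [leRHS](_ : _ = nu setT) // le_measure ?inE.
Qed.

Lemma coag_measure_zero A : ck chi = 0%R -> nuCoag chi ≡μ mzero ->
  coag_measure chi A = 0.
Proof. by move=> c0 nu0; rewrite /coag_measure c0 mul0e mix_zero ?adde0. Qed.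

Lemma frag_measure_zero A : ce chi = 0%R -> nuDisl chi ≡μ mzero ->
  frag_measure chi A = 0.
Proof. by move=> c0 nu0; rewrite /frag_measure c0 mul0e mix_zero ?adde0. Qed.

(** The paintbox of x gives mass at least [x 0 ^+ m] to the cylinder on which the
    first m integers form one block, and a nonincreasing x with [x 0 = 0] vanishes. *)
Lemma nuCoag_zero (m : nat) : (0 < m)%N ->
  paintbox_mix (nuCoag chi) (restr m @^-1` [set ptn1 _]) = 0 ->
  nuCoag chi ≡μ mzero.
Proof.
move=> m0 mix0; apply: mzero_setT.
pose g (x : mass_ptn R) := (x 0%N ^+ m)%R.
have mg : measurable_fun setT g by apply: measurable_funX; exact: measurable_mass.
have gx0 x : (g x == 0)%R = (x 0%N == 0)%R by rewrite expf_eq0 m0.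
have nug : nuCoag chi [set x | g x != 0]%R = 0.
  apply: null_neq0_of_integral_eq0 mg _ _ mix0 => x; first by rewrite exprn_ge0 ?mass_ge0.
  have := @paintbox_ge R x m (fun=> 1%:Z) (x 0%N) (mass_ge0 _ _).
  rewrite (_ : restr m _ = ptn1 _); last by apply: ptn_ext => i j /=; rewrite eqxx.
  by apply => i _; left; exists 0%N.
have E : [set x : mass_ptn R | forall i, x i = 0%R] = ~` [set x | g x != 0]%R.
  apply/seteqP; split => x /=.
    by move=> h; apply/negP; rewrite negbK gx0 h.
  move=> /negP; rewrite negbK gx0 => /eqP x0 i; apply/le_anti.
  by rewrite mass_ge0 andbT -x0 mass_le.
have mA : measurable [set x | g x != 0]%R.
  exact: measurable_neq0.
have mAC : measurable [set x : mass_ptn R | forall i, x i = 0%R].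
  by rewrite E; exact: measurableC.
by have := null_setU mA mAC nug (nuCoag_0 chi); rewrite E setUv.
Qed.

(** Off x = (1, 0, 0, ...), either [x 1 > 0], and then a gets the first colour and
    the other integers the second one with probability at least [x 1 ^+ m], or
    [x 1 = 0] and [x 0 < 1], and then all of the first m integers are in the dust
    with probability [(1 - x 0) ^+ m]. *)
Lemma nuDisl_zero (m : nat) (a c : 'I_m) : a != c ->
  paintbox_mix (nuDisl chi) (restr m @^-1` [set restr m (eps1 a)]) = 0 ->
  paintbox_mix (nuDisl chi) (restr m @^-1` [set ptn0 _]) = 0 ->
  nuDisl chi ≡μ mzero.
Proof.
move=> ac mixa mix0; apply: mzero_setT.
have m0 : (0 < m)%N by apply: leq_trans (ltn_ord a).
have sum1 (x : mass_ptn R) : x 1%N = 0%R -> \sum_(0 <= k <oo) (x k)%:E = (x 0%N)%:E.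
  move=> x1; rewrite nneseries_recl // => [|k _]; last by rewrite lee_fin mass_ge0.
  rewrite eseries0 ?adde0 // => k k1 _; congr EFin; apply/le_anti.
  by rewrite mass_ge0 andbT -x1 mass_le.
have x0_le1 (x : mass_ptn R) : (x 0%N <= 1)%R.
  rewrite -lee_fin; apply: le_trans (mass_sum x).
  apply: le_trans (nneseries_lim_ge 1 _); last by move=> k _ _; rewrite lee_fin mass_ge0.
  by rewrite big_nat1.
pose g (x : mass_ptn R) := (x 1%N ^+ m)%R.
pose h (x : mass_ptn R) := (\1_[set y : mass_ptn R | y 1%N = 0%R] x * (1 - x 0%N) ^+ m)%R.
have mg : measurable_fun setT g by apply: measurable_funX; exact: measurable_mass.
have mx1 : measurable [set y : mass_ptn R | y 1%N = 0%R].
  rewrite (_ : [set y | _] = setT `&` (fun y : mass_ptn R => y 1%N) @^-1` [set 0%R]).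
    exact: measurable_mass.
  by rewrite setTI.
have mh : measurable_fun setT h.
  apply: measurable_funM; first exact: measurable_indic.
  apply: measurable_funX; apply: measurable_funB; first exact: measurable_cst.
  exact: measurable_mass.
have gx0 x : (g x == 0)%R = (x 1%N == 0)%R by rewrite expf_eq0 m0.
have nug : nuDisl chi [set x | g x != 0]%R = 0.
  apply: null_neq0_of_integral_eq0 mg _ _ mixa => x; first by rewrite exprn_ge0 ?mass_ge0.
  pose col (i : nat) : int := if i == a then 1%:Z else 2%:Z.
  have := @paintbox_ge R x m col (x 1%N) (mass_ge0 _ _).
  rewrite (_ : restr m _ = restr m (eps1 a)).
    apply => i _; left; rewrite /col; case: ifP => _; last by exists 1%N.
    by exists 0%N => //; exact: mass_le.
  by apply: ptn_ext => i j /=; rewrite /col; case: ifP; case: ifP.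
have nuh : nuDisl chi [set x | h x != 0]%R = 0.
  apply: null_neq0_of_integral_eq0 mh _ _ mix0 => x.
    by rewrite mulr_ge0 ?exprn_ge0 ?subr_ge0 // indicE.
  have [x1|x1] := pselect (x 1%N = 0%R); last first.
    by rewrite /h indicE memNset // mul0r; exact: measure_ge0.
  rewrite /h indicE mem_set // mul1r.
  have dust0 : (0 <= 1 - x 0%N)%R by rewrite subr_ge0.
  have := @paintbox_ge R x m (fun i => - i.+1%:Z)%R _ dust0.
  rewrite (_ : restr m _ = ptn0 _); last first.
    by apply: ptn_ext => i j /=; rewrite eqr_opp eqz_nat eqSS.
  by apply => i _; right; rewrite sum1 // EFinB.
have mA : measurable [set x | g x != 0]%R by exact: measurable_neq0.
have mB : measurable [set x | h x != 0]%R by exact: measurable_neq0.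
have E : [set x : mass_ptn R | x 0%N = 1%R /\ forall i, x i.+1 = 0%R] =
    ~` ([set x | g x != 0]%R `|` [set x | h x != 0]%R).
  apply/seteqP; split => x /=.
    move=> [x0 x1] [|]; first by rewrite gx0 x1 eqxx.
    by rewrite /h x0 subrr expr0n gtn_eqF // mulr0 eqxx.
  move=> /not_orP[/negP]; rewrite negbK gx0 => /eqP x1 /negP; rewrite negbK.
  rewrite /h indicE mem_set // mul1r expf_eq0 m0 subr_eq0 => /eqP x0; split => // i.
  by apply/le_anti; rewrite mass_ge0 andbT -x1 mass_le.
have mAB := measurableU _ _ mA mB.
have mC : measurable [set x : mass_ptn R | x 0%N = 1%R /\ forall i, x i.+1 = 0%R].
  by rewrite E; exact: measurableC.
have := null_setU mAB mC (null_setU mA mB nug nuh) (nuDisl_1 chi).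
by rewrite E setUv.
Qed.

(** Kingman coalescence gives mass [ck chi] to merging a and b alone, and the
    paintboxes of nuCoag put all of the first m integers in one block. *)
Lemma coag_positive (m : nat) (a b : 'I_m) : a != b ->
  ~ (ck chi = 0%R /\ nuCoag chi ≡μ mzero) ->
  exists2 s : ptn 'I_m, s a b & 0 < coag_measure chi (restr m @^-1` [set s]).
Proof.
wlog ab : a b / (a < b)%N.
  move=> H ab nz; have [lt|lt|/val_inj E] := ltngtP a b; first exact: H.
    have [|s sba s0] := H b a lt _ nz; first by rewrite eq_sym.
    by exists s => //; rewrite ptn_sym.
  by rewrite E eqxx in ab.
move=> _ nz; have [c0|c0] := eqVneq (ck chi) 0%R; last first.
  exists (restr m (eps2 a b)); first by rewrite /= eqxx (ltn_eqF ab).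
  apply: (@lt_le_trans _ _ (ck chi)%:E).
    by rewrite lte_fin lt_neqAle eq_sym c0 ck_ge0.
  apply: (@le_trans _ _ ((ck chi)%:E * kingman R (restr m @^-1` [set restr m (eps2 a b)]))).
    by rewrite -[leLHS]mule1 lee_wpmul2l ?lee_fin ?ck_ge0 // (kingman_ge1 ab).
  by rewrite /coag_measure leeDl // mix_ge0.
exists (ptn1 _) => //; rewrite /coag_measure c0 mul0e add0e lt_neqAle mix_ge0 andbT.
apply/eqP => /esym mix0; apply: nz; split => //; apply: nuCoag_zero mix0.
exact: leq_trans (ltn_ord a).
Qed.

(** Erosion gives mass [ce chi] to isolating a; nuDisl charges the partition that
    isolates a or the one into singletons, depending on whether two colours or dust
    occur. *)
Lemma frag_positive (m : nat) (a b : 'I_m) : a != b ->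
  ~ (ce chi = 0%R /\ nuDisl chi ≡μ mzero) ->
  exists2 s : ptn 'I_m, ~~ s a b & 0 < frag_measure chi (restr m @^-1` [set s]).
Proof.
move=> ab nz; have nab : ~~ restr m (eps1 a) a b.
  by apply: contra ab; rewrite /= eqxx => /eqP/esym/eqP/val_inj ->.
have [c0|c0] := eqVneq (ce chi) 0%R; last first.
  exists (restr m (eps1 a)) => //.
  apply: (@lt_le_trans _ _ (ce chi)%:E).
    by rewrite lte_fin lt_neqAle eq_sym c0 ce_ge0.
  apply: (@le_trans _ _ ((ce chi)%:E * erosion R (restr m @^-1` [set restr m (eps1 a)]))).
    by rewrite -[leLHS]mule1 lee_wpmul2l ?lee_fin ?ce_ge0 // (@erosion_ge1 a).
  by rewrite /frag_measure leeDl // mix_ge0.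
apply: contrapT => H; apply: nz; split => //; apply: (nuDisl_zero ab).
  apply/eqP; rewrite eq_le mix_ge0 andbT leNgt; apply/negP => mix0; apply: H.
  by exists (restr m (eps1 a)) => //; rewrite /frag_measure c0 mul0e add0e.
apply/eqP; rewrite eq_le mix_ge0 andbT leNgt; apply/negP => mix0; apply: H.
by exists (ptn0 _) => //; rewrite /frag_measure c0 mul0e add0e.
Qed.

Variable q : rates R.
Hypothesis qchi : has_characteristics q chi.

(** Two blocks are merged at positive rate, which makes the number of blocks a rank
    that strictly decreases. *)
Lemma coag_jump n (r : ptn 'I_n) : ~ (ck chi = 0%R /\ nuCoag chi ≡μ mzero) ->
  r != ptn1 _ -> exists2 r', (nblocks r' < nblocks r)%N & (0 < q r r')%R.
Proof.
move=> nz /neq_ptn1[i [j nrij]].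
have [s sij s0] : exists2 s : ptn 'I_(nblocks r), s (bidx r i) (bidx r j) &
    0 < coag_measure chi (restr (nblocks r) @^-1` [set s]).
  by apply: coag_positive nz; rewrite bidxE.
exists (coag s).
  by apply: (@nblocks_lt _ _ _ i j) => //; exact: coag_coarser.
rewrite -lte_fin (rate_coag qchi) // => s_0.
by move: sij; rewrite s_0 /= bidxE (negbTE nrij).
Qed.

(** Two elements of a block are separated at positive rate, which makes the number
    of blocks strictly increase; it is at most n. *)
Lemma frag_jump n (r : ptn 'I_n) : ~ (ce chi = 0%R /\ nuDisl chi ≡μ mzero) ->
  r != ptn0 _ -> exists2 r', (nblocks r < nblocks r')%N & (0 < q r r')%R.
Proof.
move=> nz /neq_ptn0[i [j [ij rij]]].
have ik : i \in block (bidx r i) by rewrite inE.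
have jk : j \in block (bidx r i) by rewrite inE bidxE ptn_sym.
pose a := enum_rank_in ik i; pose b := enum_rank_in ik j.
have ai : enum_val a = i by rewrite enum_rankK_in.
have bj : enum_val b = j by rewrite enum_rankK_in.
have ab : a != b by apply: contra_neq ij => E; rewrite -ai -bj E.
have [s nsab s0] := frag_positive ab nz.
have nf := frag_separates nsab; rewrite ai bj in nf.
exists (frag s); first by apply: (nblocks_lt _ rij nf); exact: frag_finer.
rewrite -lte_fin (rate_frag qchi) // => s_1.
by move: nsab; rewrite s_1.
Qed.

Lemma no_coag_absorbing n (r : ptn 'I_n) : ck chi = 0%R -> nuCoag chi ≡μ mzero ->
  r != ptn0 _ -> q (ptn0 _) r = 0%R.
Proof.
move=> c0 nu0 /eqP r0; have [[[s rE]|[k [s rE]]]|] := pselect (coag_or_frag (ptn0 _) r).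
- have s0 : s <> ptn0 _ by move=> E; apply: r0; rewrite rE E coag_ptn0.
  by apply: EFin_inj; rewrite rE (rate_coag qchi) // coag_measure_zero.
- exfalso; apply: r0; apply: ptn_ext => i j; rewrite rE.
  by apply/idP/idP => [/frag_finer|/eqP ->]; [|exact: ptn_refl].
- exact: (rate_other qchi).
Qed.

Lemma no_frag_absorbing n (r : ptn 'I_n) : ce chi = 0%R -> nuDisl chi ≡μ mzero ->
  r != ptn1 _ -> q (ptn1 _) r = 0%R.
Proof.
move=> c0 nu0 /eqP r1; have [[[s rE]|[k [s rE]]]|] := pselect (coag_or_frag (ptn1 _) r).
- by exfalso; apply: r1; apply: ptn_ext => i j; rewrite rE [LHS]coag_coarser.
- have s1 : s <> ptn1 _ by move=> E; apply: r1; rewrite rE E frag_ptn1.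
  by apply: EFin_inj; rewrite rE (rate_frag qchi) // frag_measure_zero.
- exact: (rate_other qchi).
Qed.

End Characteristics.

(** * Convergence in distribution on the space of partitions *)

Section Integrals.
Context d (T : measurableType d) (R : realType) (mu : probability T R).

Section FiniteValued.
Variables (S : finType) (h : T -> S) (g w : S -> R).
Hypothesis mh : forall s, measurable (h @^-1` [set s]).
Hypothesis muh : forall s, mu (h @^-1` [set s]) = (w s)%:E.

Let sumE : (fun x => (g (h x))%:E) =
  (fun x => \sum_s (g s)%:E * (\1_(h @^-1` [set s]) x)%:E)%E.
Proof.
apply/funext => x; rewrite (bigD1 (h x)) //= indicE mem_set // mule1 big1 ?adde0 //.
move=> s sx; rewrite indicE memNset ?mule0 //= => E.
by rewrite E eqxx in sx.
Qed.

Let int_term s : mu.-integrable setT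
  (fun x => (g s)%:E * (\1_(h @^-1` [set s]) x)%:E)%E.
Proof. by apply: integrableZl => //; exact: integrable_indic. Qed.

Lemma integrable_finite_valued : mu.-integrable setT (EFin \o (g \o h)).
Proof.
rewrite (_ : _ \o _ = (fun x => (g (h x))%:E)) // sumE.
by apply: integrable_sum => // s _; exact: int_term.
Qed.

Lemma integral_finite_valued :
  (\int[mu]_x (g (h x))%:E = (\sum_s g s * w s)%:E)%E.
Proof.
rewrite sumE integral_sum // -sumEFin; apply: eq_bigr => s _.
rewrite integralZl //; last exact: integrable_indic.
by rewrite integral_indic // setIT EFinM; congr (_ * _)%E; exact: muh.
Qed.

End FiniteValued.

Lemma Rintegral_dist (u v : T -> R) (e : R) :
  mu.-integrable setT (EFin \o u) -> mu.-integrable setT (EFin \o v) ->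
  (forall x, `|u x - v x| <= e) ->
  `|(\int[mu]_x u x) - (\int[mu]_x v x)| <= e.
Proof.
move=> iu iv uv; rewrite -RintegralB //.
have iuv : mu.-integrable setT (EFin \o (fun x => u x - v x)).
  by rewrite (_ : _ \o _ = ((EFin \o u) \- (EFin \o v))%E) //; exact: integrableB.
apply: le_trans (le_normr_Rintegral _ iuv) _ => //.
have -> : e = \int[mu]_(x in setT) e.
  by rewrite Rintegral_cst // [X in fine X]probability_setT mulr1.
apply: le_Rintegral => //; first exact: (integrable_abse iuv).
by apply: finite_measure_integrable_cst.
Qed.

Lemma integrable_bounded (u : T -> R) (M : R) : measurable_fun setT u ->
  (forall x, `|u x| <= M) -> mu.-integrable setT (EFin \o u).
Proof.
move=> mu_ uM; apply: measurable_bounded_integrable => //.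
  by rewrite (le_lt_trans (probability_le1 _ _)) // ltry.
by exists M; split; [exact: num_real|move=> y My x _ /=; exact: le_trans (ltW My)].
Qed.

End Integrals.

Section ContinuousFunctions.
Variables (R : realType) (f : ptn nat -> R).
Hypothesis cf : continuous f.

(** The sets of partitions near which the restriction to [n] determines f up to e
    are open, increase with n, and cover the compact space of partitions. *)
Lemma ptn_uniformly_continuous (e : R) : 0 < e ->
  exists n, forall p p', restr n p = restr n p' -> `|f p - f p'| <= e.
Proof.
move=> e0.
pose U n : set (ptn nat) := [set p | forall p' p'', restr n p = restr n p' ->
  restr n p = restr n p'' -> `|f p' - f p''| <= e].
have Ule m n : (m <= n)%N -> U m `<=` U n.
  move=> mn p Ump p' p'' pp' pp''; apply: Ump.
    exact: (agree_le mn (pp' : agree n p p')).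
  exact: (agree_le mn (pp'' : agree n p p'')).
have := compact_ptn; rewrite compact_cover => /(_ nat setT U) [].
- by move=> n _; rewrite openE => p Up; exists n => // x px p' p''; rewrite -px; exact: Up.
- move=> p _; have e2 : 0 < e / 2 by rewrite divr_gt0.
  have /cvgrPdist_le/(_ _ e2)[n _ nU] := @cf p.
  exists n => // p' p'' /nU h' /nU h''; rewrite distrC in h'.
  have := ler_distD (f p) (f p') (f p''); lra.
move=> D _ DU; exists (\max_(i <- finmap.enum_fset D) i) => p p' pp'.
have [j /= jD /Ule Up] := DU p I.
by apply: (Up (\max_(i <- finmap.enum_fset D) i)) pp' => //; exact: leq_bigmax_seq.
Qed.

Lemma ptn_cylinder_approx (e : R) : 0 < e ->
  exists n (g : ptn 'I_n -> R), forall p, `|f p - g (restr n p)| <= e.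
Proof.
move=> /ptn_uniformly_continuous[n nf].
exists n, (fun r => f (xget (ptn0 nat) [set p | restr n p = r])) => p.
apply: nf; symmetry.
by apply: (@xgetPex _ (ptn0 nat) [set p' | restr n p' = restr n p]); exists p.
Qed.

Lemma ptn_continuous_measurable : measurable_fun setT f.
Proof.
apply: (measurability _ (RGenOpens.measurableE R)) => _ [_ [a [b ->]] <-].
rewrite setTI; apply: sub_sigma_algebra.
by move/continuousP : cf; apply; exact: interval_open.
Qed.

End ContinuousFunctions.

(** A continuous function is within e / 3 of a function of a restriction, whose
    integral is a finite sum of probabilities of cylinders. *)
Lemma cvg_in_distribution_cylinders (R : realType) d (Omega : measurableType d)
    (P : probability Omega R) (X : R -> Omega -> ptn nat)
    (rho : probability (ptn nat) R) :
  (forall t, 0 <= t -> measurable_fun setT (X t)) ->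
  (forall n r, P (X t @^-1` (restr n @^-1` [set r])) @[t --> +oo] -->
               rho (restr n @^-1` [set r])) ->
  cvg_in_distribution P X rho.
Proof.
move=> mX cvX f cf [M fM].
have mf := ptn_continuous_measurable cf.
have irho : rho.-integrable setT (EFin \o f) by exact: integrable_bounded mf fM.
have iX t : 0 <= t -> P.-integrable setT (EFin \o (f \o X t)).
  move=> t0; apply: (@integrable_bounded _ _ _ _ _ M) => [|w]; last exact: fM.
  by apply: measurableT_comp => //; exact: mX.
have -> : (\int[rho]_x (f x)%:E = (\int[rho]_x f x)%:E)%E.
  by rewrite /Rintegral fineK //; exact: (integrable_fin_num _ irho).
apply: (@cvg_near_eq _ _ _ _ (fun t => (\int[P]_w f (X t w))%:E)).
  near=> t; have t0 : 0 <= t by near: t; apply: nbhs_pinfty_ge; rewrite num_real.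
  by rewrite /Rintegral fineK //; exact: (integrable_fin_num _ (iX _ t0)).
apply: cvg_EFin; first exact: nearW.
apply/cvgrPdist_le => e e0; have e3 : 0 < e / 3 by rewrite divr_gt0.
have [n [g fg]] := ptn_cylinder_approx cf e3.
have mcyl r : measurable (restr n @^-1` [set r]) by exact: measurable_restr.
have mXc t r : 0 <= t -> measurable (X t @^-1` (restr n @^-1` [set r])).
  by move=> t0; rewrite -[X in measurable X]setTI; apply: mX.
pose w r := fine (rho (restr n @^-1` [set r])).
pose W t r := fine (P (X t @^-1` (restr n @^-1` [set r]))).
have wE r : rho (restr n @^-1` [set r]) = (w r)%:E by rewrite fineK ?fin_num_measure.
have WE t r : 0 <= t -> P (X t @^-1` (restr n @^-1` [set r])) = (W t r)%:E.
  by move=> t0; rewrite fineK // fin_num_measure //; exact: mXc.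
have cvG : \sum_r g r * W t r @[t --> +oo] --> \sum_r g r * w r.
  apply: cvg_fsum => r _; apply: cvgM; first exact: cvg_cst.
  by apply: fine_cvg; rewrite -wE; exact: cvX.
have h1 : `|\int[rho]_x f x - \sum_r g r * w r| <= e / 3.
  have -> : \sum_r g r * w r = \int[rho]_x g (restr n x).
    by rewrite /Rintegral (integral_finite_valued (h := restr n) g mcyl wE).
  apply: Rintegral_dist => //.
  exact: (@integrable_finite_valued _ _ _ rho _ (restr n) g mcyl).
have h2 t : 0 <= t -> `|\int[P]_x f (X t x) - \sum_r g r * W t r| <= e / 3.
  move=> t0; have -> : \sum_r g r * W t r = \int[P]_x g (restr n (X t x)).
    rewrite /Rintegral (integral_finite_valued (h := restr n \o X t) g (w := W t)) //.
      by move=> r; exact: mXc.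
    by move=> r; exact: WE.
  apply: Rintegral_dist; [exact: iX| |by move=> x; exact: fg].
  by apply: (@integrable_finite_valued _ _ _ P _ (restr n \o X t) g) => r; exact: mXc.
near=> t.
have t0 : 0 <= t by near: t; apply: nbhs_pinfty_ge; rewrite num_real.
have h3 : `|\sum_r g r * w r - \sum_r g r * W t r| <= e / 3.
  by near: t; move/cvgrPdist_le: cvG; apply.
have h4 := h2 _ t0; rewrite distrC in h4.
have := ler_distD (\sum_r g r * w r) (\int[rho]_x f x) (\int[P]_x f (X t x)).
have := ler_distD (\sum_r g r * W t r) (\sum_r g r * w r) (\int[P]_x f (X t x)).
lra.
Unshelve. all: by end_near. Qed.

(** * The stationary law *)

Lemma measure_fibers d (T : measurableType d) (R : realType)
    (mu : probability T R) (S : finType) (h : T -> S) (A : set T) :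
  (forall s, measurable (h @^-1` [set s])) -> measurable A ->
  mu A = (\sum_s mu (h @^-1` [set s] `&` A))%E.
Proof.
move=> mh mA.
have mhA s : measurable (h @^-1` [set s] `&` A) by exact: measurableI.
have E B : measurable B -> mu B = (\int[mu]_x (\1_B x)%:E)%E.
  by move=> mB; rewrite integral_indic // setIT.
under eq_bigr do rewrite E //.
rewrite E // -ge0_integral_sum //; last first.
  by move=> s; apply/measurable_EFinP; exact: measurable_indic.
apply: eq_integral => x _; rewrite (bigD1 (h x)) //= big1 ?adde0.
  rewrite !indicE; congr ((nat_of_bool _)%:R%:E).
  by apply/idP/idP; rewrite !inE /=; [move=> ?; split|case].
move=> s sx; rewrite indicE memNset //= => -[E' _].
by rewrite E' eqxx in sx.
Qed.

(** Turns a set of restrictions into one over which finite sums can range. *)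
Lemma set_pred (S : Type) (B : set S) : B = [set r | r \in [pred r | `[< B r >]]].
Proof. by apply/seteqP; split => r h; [exact/asboolP|apply/asboolP]. Qed.

Lemma cvg_cylinder (R : realType) (T : Type) (F : set_system T) {FF : ProperFilter F}
    (m : T -> set (ptn nat) -> \bar R) n (l : ptn 'I_n -> \bar R) (B : {pred ptn 'I_n}) :
  (forall t A, (0 <= m t A)%E) ->
  (\forall t \near F, m t set0 = 0%E /\
    forall A A', is_cylinder A -> is_cylinder A' -> A `&` A' = set0 ->
      m t (A `|` A') = (m t A + m t A')%E) ->
  (forall r, m t (restr n @^-1` [set r]) @[t --> F] --> l r) ->
  m t (restr n @^-1` [set r | r \in B]) @[t --> F] --> (\sum_(r in B) l r)%E.
Proof.
move=> m_ge0 m_add ml.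
apply: (@cvg_near_eq _ _ _ _ (fun t => \sum_(r in B) m t (restr n @^-1` [set r]))%E).
  by apply: filterS m_add => t [m0 mU]; rewrite additive_atoms.
by apply: cvg_nnesum => r _; [apply: nearW => t; exact: m_ge0|exact: ml].
Qed.

Lemma dirac_cylindersP (R : realType) (rho : probability (ptn nat) R) (x : ptn nat) :
  rho ≡μ \d_x <->
  forall n r, rho (restr n @^-1` [set r]) = (r == restr n x)%:R%:E.
Proof.
have dE n r : (\d_x (restr n @^-1` [set r]) : \bar R) = (r == restr n x)%:R%:E.
  rewrite diracE; congr ((nat_of_bool _)%:R%:E); apply/idP/eqP; first by rewrite inE /= => ->.
  by move=> ->; rewrite inE.
split=> [E n r|E]; first by rewrite -dE; apply: E; exact: measurable_restr.
apply: ptn_measure_unique => [|n r]; last exact: etrans (E n r) (esym (dE n r)).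
by rewrite (le_lt_trans (probability_le1 _ _)) // ltry.
Qed.

(** The law at time t of the process started from rho is a measure, so it is enough
    to compare it with rho on cylinders. *)
Lemma stationary_cylinders (R : realType) (K : R -> R.-pker (ptn nat) ~> (ptn nat))
    (rho : probability (ptn nat) R) :
  (forall t n r, 0 <= t -> (\int[rho]_x K t x (restr n @^-1` [set r]) =
     rho (restr n @^-1` [set r]))%E) ->
  stationary K rho.
Proof.
move=> E t A t0 mA.
pose m (B : set (ptn nat)) := (\int[rho]_x K t x B)%E.
have m0 : m set0 = 0%E.
  by rewrite /m (eq_integral (cst 0%E)) ?integral0 // => x _; rewrite measure0.
have m_ge0 B : (0 <= m B)%E by exact: integral_ge0.
have ms : semi_sigma_additive m.
  move=> F mF tF mUF.
  have -> : m (\bigcup_n F n) = (\sum_(0 <= n <oo) m (F n))%E.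
    rewrite /m -integral_nneseries //; last by move=> n; exact: measurable_kernel.
    apply: eq_integral => x _.
    by apply/esym/cvg_lim => //; exact: measure_semi_sigma_additive.
  by apply: is_cvg_nneseries => n _ _; exact: m_ge0.
pose m' : {measure set (ptn nat) -> \bar R} :=
  HB.pack m (isMeasure.Build _ _ _ m m0 m_ge0 ms).
have mT : (m' setT < +oo)%E.
  rewrite [m' setT](_ : _ = (\int[rho]_x (cst 1 x))%E); last first.
    by apply: eq_integral => x _; exact: prob_kernel.
  by rewrite integral_cst // mul1e (le_lt_trans (probability_le1 _ _)) // ltry.
by rewrite -[LHS]/(m' A); apply: ptn_measure_unique mA => // n r; exact: E.
Qed.

Lemma cylinder_permute sigma C : is_cylinder C -> is_cylinder (permute sigma @^-1` C).
Proof.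
move=> [n [B ->]]; pose N := (\max_(i < n) sigma i).+1.
have ltN (i : 'I_n) : (sigma i < N)%N by rewrite ltnS (leq_bigmax i).
exists N, [set r | B (pullback (fun i => Ordinal (ltN i)) r)].
apply/seteqP; split => p /=; rewrite (_ : pullback _ (restr N p) = restr n (permute sigma p)) //;
  exact: ptn_ext.
Qed.

Lemma cylinder_same_block i j : is_cylinder [set p : ptn nat | p i j].
Proof.
have iN : (i < (maxn i j).+1)%N by rewrite ltnS leq_maxl.
have jN : (j < (maxn i j).+1)%N by rewrite ltnS leq_maxr.
by exists (maxn i j).+1, [set r : ptn 'I__ | r (Ordinal iN) (Ordinal jN)].
Qed.

Lemma measurable_permute sigma : measurable_fun setT (permute sigma).
Proof.
apply: measurable_fun_ptn => i j; apply: measurable_cylinder.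
exact: (cylinder_permute sigma (cylinder_same_block i j)).
Qed.

Section InvariantLaw.
Variables (R : realType) (d : measure_display) (Omega : measurableType d).
Variables (P : probability Omega R) (X : R -> Omega -> ptn nat) (q : rates R).
Variables (K : R -> R.-pker (ptn nat) ~> (ptn nat)) (chi : characteristics R).
Hypotheses (efc : EFC_process P X q K) (qchi : has_characteristics q chi).
Hypothesis nz : ~ [/\ ck chi = 0, nuCoag chi ≡μ mzero, ce chi = 0 & nuDisl chi ≡μ mzero].

Let p n := projT1 (cid (EFC_restr efc n)).
Arguments p : clear implicits.
Arguments q : clear implicits.
Let pP n := projT2 (cid (EFC_restr efc n)).

Let ptf n : transition_function (p n). Proof. by have [] := pP n. Qed.
Let prates n : transition_rates (p n) (q n). Proof. by have [] := pP n. Qed.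
Let pK n t x r : 0 <= t ->
  K t x (restr n @^-1` [set r]) = (p n t (restr n x) r)%:E.
Proof. by have [_ _ _] := pP n; apply. Qed.

(* The number of blocks is a rank when there is coalescence, its complement to n
   when there is only fragmentation. *)
Let limit_ex n : exists pi, converges_to (p n) pi.
Proof.
have [[c0 nu0]|coag] := pselect (ck chi = 0 /\ nuCoag chi ≡μ mzero); last first.
  apply: (@chain_cvg _ _ _ (ptf n) (q n) (@nblocks n) (ptn1 _) (@prates n)) => r.
  exact: (coag_jump qchi).
have frag : ~ (ce chi = 0 /\ nuDisl chi ≡μ mzero) by move=> [? ?]; exact: nz.
apply: (@chain_cvg _ _ _ (ptf n) (q n) (fun r => n - nblocks r)%N (ptn0 _)
  (@prates n)) => r.
move=> /(frag_jump qchi frag)[r' rr' qrr']; exists r' => //.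
by apply: (ltn_sub2l _ rr'); exact: leq_trans rr' (nblocks_le _).
Qed.

Let pi n := projT1 (cid (limit_ex n)).
Arguments pi : clear implicits.
Let pi_cvg n : converges_to (p n) (pi n). Proof. exact: projT2 (cid (limit_ex n)). Qed.

Let rho_ex : exists rho : probability (ptn nat) R,
  forall n r, rho (restr n @^-1` [set r]) = (pi n r)%:E.
Proof.
(* Any initial state and any sequence of times tending to infinity would do. *)
pose x0 := ptn0 nat.
have cvK n r : K k%:R x0 (restr n @^-1` [set r]) @[k --> \oo] --> (pi n r)%:E.
  apply: (@cvg_near_eq _ _ _ _ (fun k : nat => (p n k%:R (restr n x0) r)%:E)).
    by apply: nearW => k; rewrite pK.
  apply: cvg_EFin; first exact: nearW.
  apply: (@cvg_comp _ _ _ (fun k : nat => (k%:R : R))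
    (fun t => p n t (restr n x0) r) _ +oo%R); first exact: cvgr_idn.
  exact: pi_cvg.
have [|A [n [B ->]]|rho rhoE] := @probability_extension R (fun k => K k%:R x0).
- by move=> k; exact: prob_kernel.
- apply/cvg_ex; exists (\sum_(r in [pred r | `[< B r >]]) (pi n r)%:E)%E.
  rewrite [X in restr n @^-1` X]set_pred.
  apply: (@cvg_cylinder R nat \oo _ (fun k A => K k%:R x0 A) n) => //.
  apply: nearW => k; split => // C C' cC cC' CC'.
  by rewrite measureU //; exact: measurable_cylinder.
exists rho => n r; apply: (cvg_unique _ (rhoE _ (cylinder_restr _))) => //.
exact: cvK.
Qed.

Definition invariant_law : probability (ptn nat) R := projT1 (cid rho_ex).
Local Notation rho := invariant_law.
Let rhoE n r : rho (restr n @^-1` [set r]) = (pi n r)%:E.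
Proof. exact: projT2 (cid rho_ex) n r. Qed.

Lemma invariant_law_stationary : stationary K rho.
Proof.
apply: stationary_cylinders => t n r t0.
under eq_integral do rewrite pK //.
rewrite (integral_finite_valued (h := restr n) (fun i => p n t i r) _ (@rhoE n)).
  rewrite rhoE -(converges_stationary (ptf n) (ptn0 _) (@pi_cvg n) r t0).
  by congr EFin; apply: eq_bigr => i _; rewrite mulrC.
by move=> s; exact: measurable_restr.
Qed.

Let sum_atoms (mu : probability (ptn nat) R) n (w : ptn 'I_n -> R) :
  (forall r, mu (restr n @^-1` [set r]) = (w r)%:E) -> \sum_r w r = 1.
Proof.
move=> muE; have := measure_atoms mu (fun _ : ptn 'I_n => true).
have -> : restr n @^-1` [set r | r \in (fun=> true)] = setT by apply/seteqP; split.
move=> E; apply: EFin_inj; rewrite -sumEFin -(probability_setT mu); apply: esym.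
by apply: etrans E _; apply: eq_big => // r _; exact: muE.
Qed.

Lemma invariant_law_unique (rho' : probability (ptn nat) R) : stationary K rho' -> rho' ≡μ rho.
Proof.
move=> st; apply: ptn_measure_unique => [|n r].
  by rewrite (le_lt_trans (probability_le1 _ _)) // ltry.
pose w r := fine (rho' (restr n @^-1` [set r])).
have mr s : measurable (restr n @^-1` [set s]) by exact: measurable_restr.
have wE s : rho' (restr n @^-1` [set s]) = (w s)%:E by rewrite fineK ?fin_num_measure.
apply: etrans (wE r) _; apply: etrans _ (esym (rhoE r)); congr EFin.
apply: (converges_stationary_unique (@pi_cvg n)); first exact: sum_atoms wE.
move=> t j t0; apply: EFin_inj; rewrite -wE -(st t) //.
under [RHS]eq_integral do rewrite pK //.
rewrite (integral_finite_valued (h := restr n) (fun i => p n t i j) _ wE) //.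
by congr EFin; apply: eq_bigr => i _; rewrite mulrC.
Qed.

Let mX t : 0 <= t -> measurable_fun setT (X t).
Proof. exact: (EFC_measurable efc). Qed.

Let mXI t A : 0 <= t -> measurable A -> measurable (X t @^-1` A).
Proof. by move=> t0 mA; rewrite -[X in measurable X]setTI; exact: mX. Qed.

(* Whatever its initial law, the chain on [n] converges to pi n. *)
Let law_cvg_atom n r : P (X t @^-1` (restr n @^-1` [set r])) @[t --> +oo] -->
  rho (restr n @^-1` [set r]).
Proof.
have mr s : measurable (restr n @^-1` [set s]) by exact: measurable_restr.
pose w i := fine (P (X 0 @^-1` (restr n @^-1` [set i]))).
have wE i : P (X 0 @^-1` (restr n @^-1` [set i])) = (w i)%:E.
  by rewrite fineK // fin_num_measure //; exact: mXI.
have w1 : \sum_i w i = 1.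
  have := measure_fibers P (h := restr n \o X 0) (fun s => mXI (lexx 0) (mr s)) measurableT.
  under eq_bigr do rewrite setIT wE.
  by rewrite probability_setT sumEFin => -[].
rewrite rhoE.
apply: (@cvg_near_eq _ _ _ _ (fun t => (\sum_i w i * p n t i r)%:E)); last first.
  apply: cvg_EFin; first exact: nearW.
  rewrite -[pi n r]mul1r -w1 mulr_suml; apply: cvg_fsum => i _.
  by apply: cvgM; [exact: cvg_cst|exact: pi_cvg].
near=> t; have t0 : 0 <= t by near: t; apply: nbhs_pinfty_ge; rewrite num_real.
rewrite (measure_fibers P (h := restr n \o X 0) (fun s => mXI (lexx 0) (mr s))); last exact: mXI.
rewrite -sumEFin; apply: eq_bigr => i _.
have [_ _ mc _] := pP n.
have pT : past setT (fun t w => restr n (X t w)) 0 setT.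
  have [s0 sC _] := smallest_sigma_algebra setT [set E | exists (u : R) A,
    [/\ 0 <= u <= 0, setT A & E = (fun w => restr n (X u w)) @^-1` A]].
  by have := sC _ s0; rewrite setD0.
have := mc 0 t setT i r (lexx 0) t0 pT; rewrite !setTI add0r.
by rewrite EFinM -wE.
Unshelve. all: by end_near. Qed.

Let law_cvg A : is_cylinder A -> P (X t @^-1` A) @[t --> +oo] --> rho A.
Proof.
move=> [n [B ->]]; rewrite [B]set_pred measure_atoms.
pose m t A := P (X t @^-1` A).
suff m_add : \forall t \near +oo, m t set0 = 0%E /\
    forall A A', is_cylinder A -> is_cylinder A' -> A `&` A' = set0 ->
      m t (A `|` A') = (m t A + m t A')%E.
  by apply: (cvg_cylinder _ m_add) => // r; exact: law_cvg_atom.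
near=> t; rewrite /m; have t0 : 0 <= t by near: t; apply: nbhs_pinfty_ge; rewrite num_real.
split=> [|C C' cC cC' CC']; first by rewrite preimage_set0 measure0.
rewrite preimage_setU measureU //; last by rewrite -preimage_setI CC' preimage_set0.
  by apply: mXI => //; exact: measurable_cylinder.
by apply: mXI => //; exact: measurable_cylinder.
Unshelve. all: by end_near. Qed.

(** The laws of X t are exchangeable and converge to rho on cylinders, which a
    permutation maps to cylinders. *)
Lemma invariant_law_exchangeable : exchangeable rho.
Proof.
move=> sigma A fs mA.
pose f : {mfun ptn nat >-> ptn nat} := HB.pack (permute sigma)
  (isMeasurableFun.Build _ _ _ _ _ (measurable_permute sigma)).
suff E : distribution rho f ≡μ rho by rewrite -(E A mA).
apply: ptn_measure_unique => [|n r].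
  by rewrite (le_lt_trans (probability_le1 _ _)) // ltry.
have cC := cylinder_restr [set r].
apply: (cvg_unique _ (law_cvg (cylinder_permute sigma cC))) => //.
apply: cvg_near_eq (law_cvg cC).
near=> t; have t0 : 0 <= t by near: t; apply: nbhs_pinfty_ge; rewrite num_real.
have := @EFC_exchangeable _ _ _ _ _ _ _ efc sigma
  [set y | (restr n @^-1` [set r]) (y t)] fs.
move=> /(_ _)/esym; apply; apply: sub_sigma_algebra.
by exists t, (restr n @^-1` [set r]); split => //; exact: measurable_restr.
Unshelve. all: by end_near. Qed.

(** A point mass is stationary only if no rate leads out of it, and an absorbing
    state is the limit of the chain started from it. *)
Lemma invariant_law_diracP (x : ptn nat) : rho ≡μ \d_x <->
  forall n r, r != restr n x -> q n (restr n x) r = 0.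
Proof.
rewrite dirac_cylindersP; split => [E n r rx|q0 n r].
  have piE s : pi n s = (s == restr n x)%:R by apply: EFin_inj; rewrite -rhoE E.
  have p0 t : 0 <= t -> p n t (restr n x) r = 0.
    move=> t0.
    have := converges_stationary (ptf n) (ptn0 _) (@pi_cvg n) r t0.
    rewrite piE (negbTE rx) (bigD1 (restr n x)) //= piE eqxx mul1r big1 ?addr0 //.
    by move=> i ix; rewrite piE (negbTE ix) mul0r.
  have xr : restr n x != r by rewrite eq_sym.
  apply: (cvg_unique _ (prates xr)) => //.
  apply: cvg_near_eq (cvg_cst 0); near=> h; rewrite p0 ?mulr0 //.
rewrite rhoE; congr EFin.
apply: (cvg_unique _ (@pi_cvg n (restr n x) r)) => //.
apply: cvg_near_eq (cvg_cst _).
near=> t; have t0 : 0 <= t by near: t; apply: nbhs_pinfty_ge; rewrite num_real.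
have p1 := absorbing (ptf n) (@prates n) (q0 n) t0.
have [->|rx] := eqVneq r (restr n x); first by rewrite p1.
have := transition_sum (ptf n) (restr n x) t0.
rewrite (bigD1 (restr n x)) //= p1 (bigD1 r) //= => /eqP.
rewrite -subr_eq0 addrAC subrr add0r => /eqP; set S := (X in _ + X) => S0.
have S_ge0 : 0 <= S by apply: sumr_ge0 => i _; apply: (transition_ge0 (ptf n)).
have := transition_ge0 (ptf n) (restr n x) r t0; rewrite /=; lra.
Unshelve. all: by end_near. Qed.

Lemma invariant_law_ptn0P : rho ≡μ \d_(ptn0 nat) <-> ck chi = 0 /\ nuCoag chi ≡μ mzero.
Proof.
have rE n : restr n (ptn0 nat) = ptn0 _ by exact: ptn_ext.
rewrite invariant_law_diracP; split=> [q0|[c0 nu0] n r]; last first.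
  by rewrite rE; exact: (no_coag_absorbing qchi).
apply: contrapT => nz0.
have [|r lt qr] := coag_jump qchi (r := ptn0 'I_2) nz0.
  by apply/eqP => /(congr1 (fun s : ptn 'I_2 => s ord0 ord_max)).
have := q0 2 r; rewrite rE => q0r; move: qr; rewrite q0r ?ltxx //.
by apply: contraTneq lt => ->; rewrite ltnn.
Qed.

Lemma invariant_law_ptn1P : rho ≡μ \d_(ptn1 nat) <-> ce chi = 0 /\ nuDisl chi ≡μ mzero.
Proof.
have rE n : restr n (ptn1 nat) = ptn1 _ by exact: ptn_ext.
rewrite invariant_law_diracP; split=> [q0|[c0 nu0] n r]; last first.
  by rewrite rE; exact: (no_frag_absorbing qchi).
apply: contrapT => nz0.
have [|r lt qr] := frag_jump qchi (r := ptn1 'I_2) nz0.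
  by apply/eqP => /(congr1 (fun s : ptn 'I_2 => s ord0 ord_max)).
have := q0 2 r; rewrite rE => q0r; move: qr; rewrite q0r ?ltxx //.
by apply: contraTneq lt => ->; rewrite ltnn.
Qed.

Lemma cvg_invariant_law : cvg_in_distribution P X rho.
Proof. by apply: cvg_in_distribution_cylinders => // n r; exact: law_cvg_atom. Qed.

End InvariantLaw.

Theorem theorem8 (R : realType) (d : measure_display)
    (Omega : measurableType d) (P : probability Omega R)
    (X : R -> Omega -> ptn nat) (q : rates R)
    (K : R -> R.-pker (ptn nat) ~> (ptn nat)) (chi : characteristics R) :
  EFC_process P X q K -> has_characteristics q chi ->
  ~ [/\ ck chi = 0, nuCoag chi ≡μ mzero, ce chi = 0 & nuDisl chi ≡μ mzero] ->
  exists rho : probability (ptn nat) R,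
    (stationary K rho /\
     forall rho' : probability (ptn nat) R,
       stationary K rho' -> rho' ≡μ rho) /\
    [/\ exchangeable rho,
        rho ≡μ \d_(ptn0 nat) <-> ck chi = 0 /\ nuCoag chi ≡μ mzero,
        rho ≡μ \d_(ptn1 nat) <-> ce chi = 0 /\ nuDisl chi ≡μ mzero
      & cvg_in_distribution P X rho].
Proof.
move=> efc qchi nz; exists (invariant_law efc qchi nz); split; split.
- exact: invariant_law_stationary.
- exact: invariant_law_unique.
- exact: invariant_law_exchangeable.
- exact: invariant_law_ptn0P.
- exact: invariant_law_ptn1P.
- exact: cvg_invariant_law.
Qed.
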